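(* Let $c\in[0,1]$ and $\rho>\max(c,1-c)$. Let $\{G_\iota:\iota\in I\}$ be a bounded family in the space $\mathcal H(D_{\mathbb C}(c,\rho))$ of holomorphic functions on the open disc $D_{\mathbb C}(c,\rho)=\{z\in\mathbb C:|z-c|<\rho\}$ (bounded for the topology of uniform convergence on compact subsets). Let $\{\boldsymbol\epsilon_{\iota'}=(\epsilon_{\iota',N})_{N\ge1}:\iota'\in I'\}$ be a family of sequences with $\epsilon_{\iota',N}\in[0,1]$ such that $\sup_{\iota'\in I'}\epsilon_{\iota',N}\to0$ as $N\to\infty$. Then for every $\iota\in I$ and $\iota'\in I'$ the sequence of polynomials $$P_N^{\iota,\iota'}(z)=\sum_{\nu=0}^N\binom{N}{\nu}z^\nu(1-z)^{N-\nu}\,G_\iota\Big(\nu\,\frac{1-\epsilon_{\iota',N}}{N}\Big),\qquad N\ge1,$$ converges to $G_\iota$ uniformly on every compact subset of $D_{\mathbb C}(c,\rho)$, and on each compact subset of $D_{\mathbb C}(c,\rho)$ this convergence is uniform with respect to both $\iota\in I$ and $\iota'\in I'$. *)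

(* Defs.v *)
From HB Require Import structures.
From mathcomp Require Import all_boot all_order all_algebra.
From mathcomp Require Import complex.
From mathcomp Require Import all_classical all_reals all_analysis.
Import Order.TTheory GRing.Theory Num.Theory.
Import numFieldTopology.Exports numFieldNormedType.Exports.

Set Implicit Arguments.
Unset Strict Implicit.
Unset Printing Implicit Defensive.

Local Open Scope ring_scope.
Local Open Scope classical_set_scope.
Local Open Scope complex_scope.

Definition cdisc (R : realType) (c rho : R) : set R[i] :=
  [set z : R[i] | `|z - c%:C| < rho%:C].

Definition holomorphic_on (R : realType) (U : set R[i]) (f : R[i] -> R[i]) :=
  forall z, U z -> derivable (f : R[i]^o -> R[i]^o) z 1.

(* bounded family in H(U) (topology of uniform convergence on compacta):
   uniformly bounded on every compact subset of U *)
Definition bounded_family_H (R : realType) (I : Type) (U : set R[i])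
    (G : I -> R[i] -> R[i]) :=
  (forall i, holomorphic_on U (G i)) /\
  forall K : set R[i], compact (K : set R[i]^o) -> K `<=` U ->
    exists M : R, forall i z, K z -> `|G i z| <= M%:C.

Definition bernsteinP (R : realType) (G : R[i] -> R[i]) (eps : nat -> R)
    (N : nat) (z : R[i]) : R[i] :=
  \sum_(0 <= nu < N.+1)
     ('C(N, nu))%:R * z ^+ nu * (1 - z) ^+ (N - nu)
       * G ((nu%:R * (1 - eps N) / N%:R)%:C).

(* Main.v *)
Require Import Defs.
From HB Require Import structures.
From mathcomp Require Import all_boot all_order all_algebra.
From mathcomp Require Import complex ring lra.
From mathcomp Require Import all_classical all_reals all_analysis.
Import Order.TTheory GRing.Theory Num.Theory.
Import numFieldTopology.Exports numFieldNormedType.Exports.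
Local Open Scope ring_scope.
Local Open Scope classical_set_scope.
Local Open Scope complex_scope.

(** Let r >= max(c, 1 - c) and |z - c| <= r. Multiplied by N ^ k, the modified
Bernstein polynomial of x |-> (x - c) ^ k is the k-th moment of a sum of N
independent variables with complex weights 1 - z, z at -c and 1 - eps - c. The
moments of one such variable are bounded by r ^ k, and comparing the multinomial
expansion with its non-repeating terms gives an error at most
2 k^2 (1 / N + eps) r ^ k.

A function f that is complex differentiable on the disc |x - c| <= rho, r < rho,
and bounded by M on its boundary, is a pointwise limit on the open disc of
polynomials sum_j a_j (x - c) ^ j with |a_j| <= M / rho ^ j, namely its discrete
Fourier sums over the roots of unity of order 2 ^ n. The Bernstein error at z
involves finitely many values of f only, so summing the monomial errors yields the bound
4 M (1 / N + eps) / (1 - r / rho) ^ 3 for f, uniform in everything.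

The discrete Cauchy formula behind this limit is obtained without integration.
Trapezoidal sums along the boundaries of dyadic cells are additive under bisection
and vanish on affine functions, so Goursat's argument applies to them and shows
that the sums of (f w - f x) / (w - x) over the circle tend to 0. *)

Import Normc.

(** * The real-valued modulus of a complex number *)

Section Modulus.
Context {R : realType}.
Implicit Types (x y z : R[i]).

Lemma normr_normc z : `|z| = (normc z)%:C.
Proof. by []. Qed.

Lemma normc_ge0 z : 0 <= normc z.
Proof. by case: z => a b; rewrite sqrtr_ge0. Qed.

Lemma normc_real (a : R) : normc a%:C = `|a|.
Proof. by rewrite /= expr0n /= addr0 sqrtr_sqr. Qed.

Lemma normc_nat n : normc (n%:R : R[i]) = n%:R.
Proof. by rewrite -(rmorph_nat (real_complex R)) normc_real ger0_norm. Qed.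

Lemma normcX z n : normc (z ^+ n) = normc z ^+ n.
Proof.
by elim: n => [|n IH]; rewrite ?expr0 ?normc1 // !exprS normcM IH.
Qed.

Lemma normcD_le x y : normc (x + y) <= normc x + normc y.
Proof. exact: le_normcD. Qed.

Lemma normcB_le x y : normc (x - y) <= normc x + normc y.
Proof. by rewrite -(normcN y) normcD_le. Qed.

Lemma normc_distC x y : normc (x - y) = normc (y - x).
Proof. by rewrite -normcN opprB. Qed.

Lemma normc_sum (I : Type) (s : seq I) (P : pred I) (F : I -> R[i]) :
  normc (\sum_(i <- s | P i) F i) <= \sum_(i <- s | P i) normc (F i).
Proof.
elim/big_ind2 : _ => //; first by rewrite normc0.
by move=> a1 a2 b1 b2 h1 h2; rewrite (le_trans (normcD_le _ _)) // lerD.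
Qed.

Lemma normc_mulrn z n : normc (z *+ n) = normc z *+ n.
Proof. exact: normcMn. Qed.

(** The factorisation of x^(n+1) - y^(n+1) by x - y has n + 1 terms of modulus at most r^n; the
    induction peels off one factor at a time. *)
Lemma normc_subX_le (r : R) x y n : normc x <= r -> normc y <= r ->
  normc (x ^+ n.+1 - y ^+ n.+1) <= n.+1%:R * r ^+ n * normc (x - y).
Proof.
move=> hx hy; have r0 : 0 <= r by exact: le_trans (normc_ge0 x) hx.
elim: n => [|n IH]; first by rewrite expr0 !mul1r.
have -> : x ^+ n.+2 - y ^+ n.+2 =
    x * (x ^+ n.+1 - y ^+ n.+1) + (x - y) * y ^+ n.+1.
  by rewrite mulrBl mulrBr -!exprS addrA subrK.
apply: le_trans (normcD_le _ _) _; rewrite !normcM normcX.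
have h1 : normc x * normc (x ^+ n.+1 - y ^+ n.+1) <=
    r * (n.+1%:R * r ^+ n * normc (x - y)).
  by apply: ler_pM => //; exact: normc_ge0.
have h2 : normc (x - y) * normc y ^+ n.+1 <= normc (x - y) * r ^+ n.+1.
  by apply: ler_wpM2l; [exact: normc_ge0|apply: lerXn2r; rewrite ?nnegrE ?normc_ge0].
apply: le_trans (lerD h1 h2) _.
by rewrite -[n.+2]addn1 natrD exprS; lra.
Qed.

End Modulus.

(** * Moments of Bernstein sums *)

Section BernsteinSum.
Context {R : realType}.
Implicit Types (z u v : R[i]) (g : nat -> R[i]) (N k : nat).

(** The values are indexed by the node number and not by the node, so that a recursion on N leaves
    them in place; [bernsteinP] is the instance where they sample a function. *)
Definition bsum z N g :=
  \sum_(0 <= nu < N.+1) ('C(N, nu))%:R * z ^+ nu * (1 - z) ^+ (N - nu) * g nu.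

Lemma bsum0 z g : bsum z 0 g = g 0.
Proof. by rewrite /bsum big_nat1 bin0 !expr0 !mul1r. Qed.

(** Pascal's rule, read as conditioning on one trial: failure has weight 1 - z, success has weight z
    and shifts the node number. *)
Lemma bsumS z N g :
  bsum z N.+1 g = (1 - z) * bsum z N g + z * bsum z N (g \o succn).
Proof.
rewrite {1}/bsum big_nat_recl // bin0 expr0 subn0 /=.
under eq_bigr => i _ do
  rewrite binS natrD subSS mulrDl mulrDl mulrDl.
rewrite big_split /= addrA; congr (_ + _).
  transitivity (\sum_(0 <= nu < N.+2)
     ('C(N, nu))%:R * z ^+ nu * (1 - z) ^+ (N.+1 - nu) * g nu).
    by rewrite [RHS]big_nat_recl // bin0 expr0 subn0 /=.
  rewrite big_nat_recr //= bin_small // !mul0r addr0 /bsum mulr_sumr.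
  rewrite !big_nat; apply: eq_bigr => i /andP[_ hi].
  by rewrite subSn // exprS; ring.
rewrite /bsum mulr_sumr; apply: eq_bigr => i _ /=.
by rewrite exprS; ring.
Qed.

Lemma eq_bsum z N g g' : (forall nu, (nu <= N)%N -> g nu = g' nu) ->
  bsum z N g = bsum z N g'.
Proof.
by move=> h; rewrite /bsum !big_nat; apply: eq_bigr => i /andP[_ hi]; rewrite h.
Qed.

Lemma bsum_sum z N (I : Type) (s : seq I) (F : I -> nat -> R[i]) :
  bsum z N (fun nu => \sum_(i <- s) F i nu) = \sum_(i <- s) bsum z N (F i).
Proof.
by rewrite exchange_big /=; apply: eq_bigr => nu _; rewrite mulr_sumr.
Qed.

Lemma bsumZ z N a g : bsum z N (fun nu => a * g nu) = a * bsum z N g.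
Proof. by rewrite /bsum mulr_sumr; apply: eq_bigr => nu _; rewrite mulrCA. Qed.

Lemma bsumMn z N n g : bsum z N (fun nu => g nu *+ n) = bsum z N g *+ n.
Proof. by rewrite /bsum -sumrMnl; apply: eq_bigr => nu _; rewrite mulrnAr. Qed.

(* k-th moment of the complex two-point law giving mass 1 - z to u and z to v;
   [bmoment] is the k-th moment of the sum of N independent copies *)
Definition moment z u v k := (1 - z) * u ^+ k + z * v ^+ k.

Definition bmoment z u v N k :=
  bsum z N (fun nu => (nu%:R * (v - u) + N%:R * u) ^+ k).

Lemma bmoment0 z u v k : bmoment z u v 0 k = (k == 0)%:R.
Proof. by rewrite /bmoment bsum0 !mul0r addr0 expr0n. Qed.

(** The sum of N + 1 variables is the sum of N of them plus an independent one; expand its k-th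
    power by the binomial theorem. *)
Lemma bmomentS z u v N k : bmoment z u v N.+1 k =
  \sum_(i < k.+1) (bmoment z u v N (k - i) * moment z u v i) *+ 'C(k, i).
Proof.
pose X nu : R[i] := nu%:R * (v - u) + N%:R * u.
rewrite /bmoment bsumS.
rewrite (@eq_bsum z N _ (fun nu =>
  \sum_(i < k.+1) (X nu ^+ (k - i) * u ^+ i) *+ 'C(k, i))); last first.
  by move=> nu _; rewrite -exprDn /X; congr (_ ^+ _); rewrite -natr1; ring.
rewrite (@eq_bsum z N (_ \o _) (fun nu =>
  \sum_(i < k.+1) (X nu ^+ (k - i) * v ^+ i) *+ 'C(k, i))); last first.
  by move=> nu _; rewrite -exprDn /X /=; congr (_ ^+ _); rewrite -!natr1; ring.
rewrite !bsum_sum !mulr_sumr -big_split /=; apply: eq_bigr => i _.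
rewrite !bsumMn !mulrnAr -mulrnDl; congr (_ *+ _).
rewrite (@eq_bsum z N (fun nu => _ * u ^+ i)
  (fun nu => u ^+ i * X nu ^+ (k - i))); last by move=> *; rewrite mulrC.
rewrite (@eq_bsum z N (fun nu => _ * v ^+ i)
  (fun nu => v ^+ i * X nu ^+ (k - i))); last by move=> *; rewrite mulrC.
by rewrite !bsumZ /moment; ring.
Qed.

(** Count injections of k + 1 points into N + 1: the new value is missed, or it is taken at one of
    the k + 1 points. *)
Lemma ffactSSD N k : (N.+1 ^_ k.+1 = N ^_ k.+1 + k.+1 * N ^_ k)%N.
Proof.
rewrite ffactSS ffactnSr.
have [h|h] := leqP k N; first by rewrite [X in (X + _)%N]mulnC -mulnDl addnS subnK.
by rewrite ffact_small // !muln0.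
Qed.

Section Bounds.
Variables (z u v : R[i]) (r : R).
Hypothesis momr : forall k, normc (moment z u v k) <= r ^+ k.

Lemma normc_bmoment_le N k : normc (bmoment z u v N k) <= (N%:R * r) ^+ k.
Proof.
elim: N k => [|N IH] k.
  by rewrite bmoment0 mul0r expr0n normc_nat.
rewrite bmomentS -natr1 mulrDl mul1r exprDn.
apply: le_trans (normc_sum _ _ _ _) _; apply: ler_sum => i _.
rewrite normc_mulrn normcM lerMn2r; apply/orP; right.
by apply: ler_pM; rewrite ?normc_ge0.
Qed.

(* The falling factorial counts the terms of the multinomial expansion in which
   no summand is repeated; each of them contributes the k-th power of the mean *)
Lemma normc_bmoment_ffact_le N k :
  normc (bmoment z u v N k - ((N ^_ k)%N)%:R * moment z u v 1 ^+ k)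
  <= r ^+ k * (N%:R ^+ k - ((N ^_ k)%N)%:R).
Proof.
have m0 : moment z u v 0 = 1 by rewrite /moment !expr0 !mulr1 subrK.
elim: N k => [|N IH] [|k].
- by rewrite bmoment0 ffactn0 expr0 mulr1 subrr normc0 expr0 subrr mulr0.
- by rewrite bmoment0 ffact0n /= mul0r subrr normc0 expr0n /= subrr mulr0.
- rewrite bmomentS big_ord1 /= subnn m0 mulr1 mulr1n.
  by have := IH 0%N; rewrite !ffactn0 !expr0.
(* In the terms i = 0 and i = 1 the new variable occurs at most once; they match the two terms of
   [ffactSSD]. The terms i >= 2 all contain a repetition and form the error [S]. *)
rewrite bmomentS 2!big_ord_recl /= subn0 m0 mulr1 mulr1n subSS subn0 bin1.
set m1 := moment z u v 1.
have e1 : (N.+1%:R : R) ^+ k.+1 =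
   N%:R ^+ k.+1 + (k.+1%:R * N%:R ^+ k +
     \sum_(i < k) N%:R ^+ (k.+1 - i.+2) *+ 'C(k.+1, i.+2)).
  rewrite -natr1 exprDn 2!big_ord_recl /= !subn0 mulr1 mulr1n subSS subn0 bin1.
  rewrite expr1n mulr1 mulr_natl; congr (_ + (_ + _)).
  by apply: eq_bigr => i _; rewrite expr1n mulr1.
have e2 : ((N.+1 ^_ k.+1)%N)%:R * m1 ^+ k.+1 =
   ((N ^_ k.+1)%N)%:R * m1 ^+ k.+1 + k.+1%:R * (((N ^_ k)%N)%:R * m1 ^+ k * m1).
  by rewrite ffactSSD natrD natrM exprSr; ring.
rewrite e2 e1 ffactSSD natrD natrM.
set S := (X in _ + (_ + X) - _).
have hS : normc S <= r ^+ k.+1 * \sum_(i < k) N%:R ^+ (k.+1 - i.+2) *+ 'C(k.+1, i.+2).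
  rewrite mulr_sumr; apply: le_trans (normc_sum _ _ _ _) _; apply: ler_sum => i _.
  rewrite normc_mulrn normcM mulrnAr lerMn2r; apply/orP; right.
  have -> : r ^+ k.+1 * N%:R ^+ (k.+1 - i.+2) = (N%:R * r) ^+ (k.+1 - i.+2) * r ^+ i.+2.
    by rewrite exprMn -mulrA -exprD subnK 1?mulrC // ltnS (ltn_ord i).
  by apply: ler_pM; rewrite ?normc_ge0 ?normc_bmoment_le.
set A := bmoment z u v N k.+1; set B := bmoment z u v N k.
have -> : A + ((B * m1) *+ k.+1 + S) - (((N ^_ k.+1)%N)%:R * m1 ^+ k.+1 +
     k.+1%:R * (((N ^_ k)%N)%:R * m1 ^+ k * m1)) =
   (A - ((N ^_ k.+1)%N)%:R * m1 ^+ k.+1) + (k.+1%:R * ((B - ((N ^_ k)%N)%:R * m1 ^+ k) * m1) + S).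
  by rewrite -mulr_natl; ring.
apply: le_trans (normcD_le _ _) _.
have := normcD_le (k.+1%:R * ((B - ((N ^_ k)%N)%:R * m1 ^+ k) * m1)) S.
rewrite normcM normcM normc_nat.
have hA := IH k.+1; have hB := IH k.
have hB' : normc (B - ((N ^_ k)%N)%:R * m1 ^+ k) * normc m1 <=
    r ^+ k * (N%:R ^+ k - ((N ^_ k)%N)%:R) * r.
  by apply: ler_pM; [exact: normc_ge0|exact: normc_ge0|exact: hB|exact: (momr 1)].
have hB'' := ler_wpM2l (ler0n R k.+1) hB'.
move: hS hA hB''; rewrite -/A -/B -/m1 !exprSr => hS hA hB''.
set T := \sum_(i < k) _ in hS *.
lra.
Qed.

(** Among the N^k tuples at most k^2 N^(k-1) repeat an entry. Multiplying by N avoids the exponent k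
    - 1. *)
Lemma natrX_sub_ffact_le N k :
  N%:R * (N%:R ^+ k - ((N ^_ k)%N)%:R) <= k%:R ^+ 2 * N%:R ^+ k :> R.
Proof.
elim: k => [|k IH]; first by rewrite ffactn0 expr0 subrr mulr0 expr0n mul0r.
have h1 : ((N ^_ k)%N)%:R <= N%:R ^+ k :> R.
  rewrite -natrX ler_nat; elim: k {IH} => // k IH.
  by rewrite ffactnSr expnSr leq_mul // leq_subr.
(* The truncated difference of naturals is at least the real one, so k > N needs no separate
   case. *)
have h2 : (N%:R - k%:R) * ((N ^_ k)%N)%:R <= ((N ^_ k.+1)%N)%:R :> R.
  rewrite ffactnSr natrM mulrC ler_wpM2l //.
  by rewrite lerBlDr -natrD ler_nat addnC -leq_subLR.
have N0 : 0 <= N%:R :> R by [].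
have k0 : 0 <= k%:R :> R by [].
have := ler_wpM2l N0 IH; have := ler_wpM2l (mulr_ge0 N0 k0) h1; have := ler_wpM2l N0 h2.
have X0 : 0 <= N%:R ^+ k :> R by exact: exprn_ge0.
have := mulr_ge0 N0 X0; have := mulr_ge0 (mulr_ge0 N0 k0) X0.
rewrite [N%:R ^+ k.+1]exprS -natr1.
move: ((N%:R : R) ^+ k) (N%:R : R) (k%:R : R) (((N ^_ k)%N)%:R : R)
  (((N ^_ k.+1)%N)%:R : R) => X n k' f f1.
by move=> *; lra.
Qed.

End Bounds.
End BernsteinSum.

(** * The Bernstein error for the powers of x - c *)

Section BernsteinPower.
Context {R : realType}.
Implicit Types (z : R[i]).

Lemma moment_rec z u v k : moment z u v k.+2 =
  (u + v) * moment z u v k.+1 - u * v * moment z u v k.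
Proof. by rewrite /moment !exprS; ring. Qed.

Variables (c r : R).
Hypotheses (c01 : 0 <= c <= 1) (cr : c <= r) (cr' : 1 - c <= r).

Let r0 : 0 <= r.
Proof. by apply: le_trans cr; case/andP: c01. Qed.

(* The moments satisfy a two-step recursion whose characteristic roots are -c
   and 1 - c, and r is at least the modulus of both *)
Lemma normc_moment1_le z k : normc (z - c%:C) <= r ->
  normc (moment z (- c)%:C (1 - c)%:C k) <= r ^+ k.
Proof.
move=> hz; have /andP[c0 c1] := c01.
suff [//] : normc (moment z (- c)%:C (1 - c)%:C k) <= r ^+ k /\
  normc (moment z (- c)%:C (1 - c)%:C k.+1) <= r ^+ k.+1.
elim: k => [|k [IH1 IH2]].
  split; first by rewrite /moment !expr0 !mulr1 subrK normc1.
  rewrite /moment !expr1.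
  suff -> : (1 - z) * (- c)%:C + z * (1 - c)%:C = z - c%:C by [].
  by rewrite rmorphB rmorphN rmorph1; ring.
split=> //; rewrite moment_rec.
apply: le_trans (normcB_le _ _) _; rewrite !normcM -rmorphD !normc_real.
have h1 : `|- c + (1 - c)| * normc (moment z (- c)%:C (1 - c)%:C k.+1) <=
  `|- c + (1 - c)| * r ^+ k.+1 by exact: ler_wpM2l.
have h2 : `|- c| * `|1 - c| * normc (moment z (- c)%:C (1 - c)%:C k) <=
  c * (1 - c) * r ^+ k.
  by rewrite normrN !ger0_norm ?subr_ge0 // ler_wpM2l // mulr_ge0 // subr_ge0.
apply: le_trans (lerD h1 h2) _; rewrite !exprS.
suff : `|- c + (1 - c)| * r + c * (1 - c) <= r * r.
  by move=> /(ler_wpM2r (exprn_ge0 k r0)); lra.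
(* By the sign of 1 - 2c, the difference of the two sides factors as (r - (1 - c)) (r + c) or as (r
   - c) (r + (1 - c)). *)
case: (ger0P (- c + (1 - c))) => h.
  have := mulr_ge0 (_ : 0 <= r - (1 - c)) (_ : 0 <= r + c); rewrite subr_ge0.
  by move=> /(_ cr' (addr_ge0 r0 c0)); lra.
have := mulr_ge0 (_ : 0 <= r - c) (_ : 0 <= r + (1 - c)); rewrite subr_ge0.
by move=> /(_ cr (addr_ge0 r0 _)); rewrite subr_ge0 => /(_ c1); lra.
Qed.

(* The points -c and s - c are the images of -c and 1 - c under the affine map
   y |-> s y - c (1 - s), which maps the disc of radius r into itself *)
Lemma normc_moment_le (s : R) z k : 0 <= s <= 1 -> normc (z - c%:C) <= r ->
  normc (moment z (- c)%:C (s - c)%:C k) <= r ^+ k.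
Proof.
move=> /andP[s0 s1] hz; have /andP[c0 c1] := c01.
pose t := c * (1 - s).
have t0 : 0 <= t by rewrite mulr_ge0 // subr_ge0.
have -> : moment z (- c)%:C (s - c)%:C k = \sum_(i < k.+1)
   (moment z (- c)%:C (1 - c)%:C (k - i) * (s%:C ^+ (k - i) * (- t)%:C ^+ i)) *+ 'C(k, i).
  have -> : (- c)%:C = s%:C * (- c)%:C + (- t)%:C.
    by rewrite -rmorphM -rmorphD /t; congr (_%:C); ring.
  have -> : (s - c)%:C = s%:C * (1 - c)%:C + (- t)%:C.
    by rewrite -rmorphM -rmorphD /t; congr (_%:C); ring.
  rewrite {1}/moment !exprDn !mulr_sumr -big_split /=; apply: eq_bigr => i _.
  have -> : s%:C * (- c)%:C + (- t)%:C = (- c)%:C.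
    by rewrite -rmorphM -rmorphD /t; congr (_%:C); ring.
  rewrite /moment !mulrnAr -mulrnDl; congr (_ *+ _).
  by rewrite !exprMn; ring.
apply: le_trans (normc_sum _ _ _ _) _.
have h : s * r + t <= r.
  have := mulr_ge0 (_ : 0 <= 1 - s) (_ : 0 <= r - c).
  by rewrite !subr_ge0 => /(_ s1 cr); rewrite /t; lra.
have h' : (s * r + t) ^+ k <= r ^+ k.
  by rewrite lerXn2r ?nnegrE // addr_ge0 // mulr_ge0.
apply: le_trans h'; rewrite exprDn; apply: ler_sum => i _.
rewrite normc_mulrn !normcM !normcX !normc_real normrN !ger0_norm //.
rewrite lerMn2r; apply/orP; right.
rewrite [(s * r) ^+ _]exprMn mulrA [s ^+ _ * _]mulrC.
by rewrite !ler_wpM2r ?exprn_ge0 // normc_moment1_le.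
Qed.

Lemma normc_bsum_powB_le (eps : R) z N k : (0 < N)%N -> 0 <= eps <= 1 ->
  normc (z - c%:C) <= r ->
  normc (bsum z N (fun nu => ((nu%:R * (1 - eps) / N%:R)%:C - c%:C) ^+ k)
         - (z - c%:C) ^+ k)
  <= 2 * (N%:R^-1 + eps) * (k%:R ^+ 2 * r ^+ k).
Proof.
move=> N0 /andP[e0 e1] hz; have /andP[c0 c1] := c01.
have n0 : 0 < N%:R :> R by rewrite ltr0n.
have n0' : N%:R != 0 :> R[i] by rewrite pnatr_eq0 -lt0n.
pose s := 1 - eps.
have s01 : 0 <= s <= 1 by rewrite /s subr_ge0 e1 gerBl.
pose u := (- c)%:C : R[i]; pose v := (s - c)%:C : R[i].
have momr j : normc (moment z u v j) <= r ^+ j by exact: normc_moment_le.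
(* N times the centred node is nu (1 - eps) - N c, that is nu (v - u) + N u. *)
have -> : bsum z N (fun nu => ((nu%:R * (1 - eps) / N%:R)%:C - c%:C) ^+ k) =
   (N%:R ^+ k)^-1 * bmoment z u v N k.
  rewrite /bmoment -bsumZ; apply: eq_bsum => nu _.
  rewrite -exprVn -exprMn; congr (_ ^+ _).
  rewrite -/s /u /v.
  have -> : (s - c)%:C = s%:C - c%:C :> R[i] by rewrite rmorphB.
  have -> : (- c)%:C = - c%:C :> R[i] by rewrite rmorphN.
  rewrite !rmorphM fmorphV !rmorph_nat /=.
  by field.
set m1 := moment z u v 1; set M := bmoment z u v N k.
(* The factor 2 counts two errors of equal size: the terms with repetitions in [M], and the N^k -
   N^_k copies of m1^k to be added. *)
have hM : normc (M - N%:R ^+ k * m1 ^+ k) <=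
    2 * (r ^+ k * (N%:R ^+ k - ((N ^_ k)%N)%:R)).
  have -> : M - N%:R ^+ k * m1 ^+ k = (M - ((N ^_ k)%N)%:R * m1 ^+ k) -
     (N%:R ^+ k - ((N ^_ k)%N)%:R) * m1 ^+ k by ring.
  apply: le_trans (normcB_le _ _) _; rewrite normcM.
  have h1 := normc_bmoment_ffact_le _ _ _ _ momr N k.
  have hf : 0 <= N%:R ^+ k - ((N ^_ k)%N)%:R :> R.
    rewrite subr_ge0 -natrX ler_nat; elim: k {M h1} => // k IH.
    by rewrite ffactnSr expnSr leq_mul // leq_subr.
  have -> : @normc R (N%:R ^+ k - ((N ^_ k)%N)%:R) = N%:R ^+ k - ((N ^_ k)%N)%:R.
    transitivity (@normc R (N%:R ^+ k - ((N ^_ k)%N)%:R)%:C).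
      by rewrite rmorphB rmorphXn !rmorph_nat.
    by rewrite normc_real ger0_norm.
  have h2 : normc (m1 ^+ k) <= r ^+ k.
    by rewrite normcX lerXn2r ?nnegrE ?normc_ge0 // (momr 1%N).
  by have := ler_wpM2l hf h2; rewrite -/M -/m1 in h1 *; lra.
have hX0 : 0 <= r ^+ k by exact: exprn_ge0.
have hk0 : 0 <= k%:R :> R by [].
have hA : normc ((N%:R ^+ k)^-1 * M - m1 ^+ k) <= 2 * N%:R^-1 * (k%:R ^+ 2 * r ^+ k).
  have -> : (N%:R ^+ k)^-1 * M - m1 ^+ k = (N%:R ^+ k)^-1 * (M - N%:R ^+ k * m1 ^+ k).
    by rewrite mulrBr mulKf // expf_neq0.
  rewrite normcM normcV normcX normc_nat.
  rewrite ler_pdivrMl ?exprn_gt0 //; apply: le_trans hM _.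
  rewrite -(ler_pM2l n0).
  have := ler_wpM2l hX0 (@natrX_sub_ffact_le R N k).
  have -> : N%:R * (N%:R ^+ k * (2 * N%:R^-1 * (k%:R ^+ 2 * r ^+ k))) =
     2 * (N%:R ^+ k * (k%:R ^+ 2 * r ^+ k)) :> R.
    by field; rewrite gt_eqF.
  by lra.
  (* the mean differs from z - c by eps z, and |z| <= 2 r *)
  have hB : normc (m1 ^+ k - (z - c%:C) ^+ k) <= 2 * eps * (k%:R ^+ 2 * r ^+ k).
  case: k {M hM hX0 hA} hk0 => [|k] hk0.
    by rewrite !expr0 subrr normc0 expr0n /= mul0r mulr0.
  have hm : normc (m1 - (z - c%:C)) <= 2 * r * eps.
    have -> : m1 - (z - c%:C) = - (eps%:C * ((z - c%:C) + c%:C)).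
      rewrite /m1 /moment !expr1 /u /v rmorphN rmorphB /s rmorphB rmorph1; ring.
    rewrite normcN normcM normc_real ger0_norm // mulrC ler_wpM2r //.
    apply: le_trans (normcD_le _ _) _; rewrite normc_real ger0_norm //; have := lerD hz cr; lra.
  apply: le_trans (normc_subX_le r _ _ _ _ hz) _; first by rewrite -[r]expr1; exact: momr.

  have h1 : 0 <= k.+1%:R * r ^+ k by rewrite mulr_ge0 // exprn_ge0.
  have := ler_wpM2l h1 hm.
  have h2 : k.+1%:R <= k.+1%:R ^+ 2 :> R by rewrite -natrX ler_nat leq_pmulr.
  have h3 : 0 <= eps * (r * r ^+ k) by rewrite !mulr_ge0 // exprn_ge0.
  have := ler_wpM2r h3 h2; rewrite [r ^+ k.+1]exprS; lra.
have -> : (N%:R ^+ k)^-1 * M - (z - c%:C) ^+ k =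
  ((N%:R ^+ k)^-1 * M - m1 ^+ k) + (m1 ^+ k - (z - c%:C) ^+ k) by rewrite addrA subrK.
apply: le_trans (normcD_le _ _) _; lra.
Qed.

Lemma sum_sqr_geo_le (q : R) n : 0 <= q < 1 ->
  \sum_(k < n) k%:R ^+ 2 * q ^+ k <= 2 / (1 - q) ^+ 3.
Proof.
move=> /andP[q0 q1]; rewrite ler_pdivlMr ?exprn_gt0 ?subr_gt0 //.
(* q^n T(n) / (1 - q)^3 is the tail of the series from k = n on, and the whole series is q (1 + q) /
   (1 - q)^3. *)
pose T m := (1 - q) ^+ 2 * m%:R ^+ 2 + 2 * q * (1 - q) * m%:R + q * (1 + q).
have -> : (\sum_(k < n) k%:R ^+ 2 * q ^+ k) * (1 - q) ^+ 3 =
  q + q ^+ 2 - q ^+ n * T n.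
  rewrite /T; elim: n => [|n IH]; first by rewrite big_ord0; ring.
  by rewrite big_ord_recr /= mulrDl IH -[n.+1%:R]natr1 [q ^+ n.+1]exprS; ring.
have : 0 <= q ^+ n * T n.
  have ? : 0 <= 1 - q by rewrite subr_ge0 ltW.
  by rewrite mulr_ge0 ?exprn_ge0 // !addr_ge0 // !mulr_ge0 // ?addr_ge0 // exprn_ge0.
have := mulr_ge0 q0 (_ : 0 <= 1 - q); rewrite subr_ge0 => /(_ (ltW q1)).
lra.
Qed.

End BernsteinPower.

(** * Goursat's theorem for trapezoidal sums *)

Section Trapezoid.
Context {R : realType}.
Variable Phi : R -> R -> R[i].
Implicit Types (g h : R[i] -> R[i]) (p q z : R[i]) (n a b l : nat).

(** The first-order expansion with real tolerances; [complex_diffP] identifies it with derivability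
    over [R[i]]. *)
Definition complex_diff g z := exists d : R[i], forall e : R, 0 < e ->
  exists2 eta : R, 0 < eta & forall w, normc (w - z) < eta ->
    normc (g w - g z - d * (w - z)) <= e * normc (w - z).

Definition trap g p q := (q - p) * ((g p + g q) / 2).

Definition grid n a b := Phi (a%:R / 2 ^+ n) (b%:R / 2 ^+ n).

Definition hsum g n a b l :=
  \sum_(k < l) trap g (grid n (a + k) b) (grid n (a + k).+1 b).

Definition vsum g n a b l :=
  \sum_(k < l) trap g (grid n a (b + k)) (grid n a (b + k).+1).

(** A discrete contour integral, counterclockwise in parameter space: bottom, right, top, left, with
    steps 2^-n. *)
Definition square_sum g n a b l :=
  hsum g n a b l + vsum g n (a + l) b l - hsum g n a (b + l) l - vsum g n a b l.

Lemma hsum_cat g n a b l :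
  hsum g n a b (l + l) = hsum g n a b l + hsum g n (a + l) b l.
Proof.
rewrite /hsum big_split_ord /=; congr (_ + _).
by apply: eq_bigr => i _; rewrite addnA.
Qed.

Lemma vsum_cat g n a b l :
  vsum g n a b (l + l) = vsum g n a b l + vsum g n a (b + l) l.
Proof.
rewrite /vsum big_split_ord /=; congr (_ + _).
by apply: eq_bigr => i _; rewrite addnA.
Qed.

(** All sums use the same grid, so the inner edges are traversed twice in opposite directions and
    cancel. *)
Lemma square_sum_quarter g n a b l : square_sum g n a b (l + l) =
  square_sum g n a b l + square_sum g n (a + l) b l +
  square_sum g n a (b + l) l + square_sum g n (a + l) (b + l) l.
Proof. by rewrite /square_sum !hsum_cat !vsum_cat !addnA; ring. Qed.

Lemma trapB g h p q : trap (fun z => g z - h z) p q = trap g p q - trap h p q.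
Proof. by rewrite /trap; field. Qed.

Lemma square_sumB g h n a b l : square_sum (fun z => g z - h z) n a b l =
  square_sum g n a b l - square_sum h n a b l.
Proof.
have hB a' b' : hsum (fun z => g z - h z) n a' b' l =
    hsum g n a' b' l - hsum h n a' b' l.
  by rewrite /hsum -sumrB; apply: eq_bigr => i _; exact: trapB.
have vB a' b' : vsum (fun z => g z - h z) n a' b' l =
    vsum g n a' b' l - vsum h n a' b' l.
  by rewrite /vsum -sumrB; apply: eq_bigr => i _; exact: trapB.
by rewrite /square_sum !hB !vB; ring.
Qed.

(* the trapezoid rule integrates an affine map exactly: its values telescope
   along the antiderivative *)
Lemma square_sum_affine al be n a b l :
  square_sum (fun z => al + be * z) n a b l = 0.
Proof.
pose Q z : R[i] := al * z + be * z ^+ 2 / 2.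
have trapE p q : trap (fun z => al + be * z) p q = Q q - Q p.
  by rewrite /trap /Q; field.
have hE a' b' : hsum (fun z => al + be * z) n a' b' l =
    Q (grid n (a' + l) b') - Q (grid n a' b').
  rewrite /hsum; under eq_bigr do rewrite trapE -addnS.
  rewrite -(big_mkord xpredT (fun k => Q (grid n (a' + k.+1) b') - Q (grid n (a' + k) b'))).
  by rewrite (telescope_sumr (fun k => Q (grid n (a' + k) b'))) // addn0.
have vE a' b' : vsum (fun z => al + be * z) n a' b' l =
    Q (grid n a' (b' + l)) - Q (grid n a' b').
  rewrite /vsum; under eq_bigr do rewrite trapE -addnS.
  rewrite -(big_mkord xpredT (fun k => Q (grid n a' (b' + k.+1)) - Q (grid n a' (b' + k)))).
  by rewrite (telescope_sumr (fun k => Q (grid n a' (b' + k)))) // addn0.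
by rewrite /square_sum !hE !vE; ring.
Qed.

Variable L : R.
Hypothesis lip : forall s t s' t' : R,
  0 <= s <= 1 -> 0 <= t <= 1 -> 0 <= s' <= 1 -> 0 <= t' <= 1 ->
  normc (Phi s t - Phi s' t') <= L * (`|s - s'| + `|t - t'|).

Lemma dyadic01 n a : (a <= 2 ^ n)%N -> 0 <= (a%:R / 2 ^+ n : R) <= 1.
Proof.
move=> h; rewrite divr_ge0 ?exprn_ge0 //= ler_pdivrMr ?exprn_gt0 //.
by rewrite mul1r -natrX ler_nat.
Qed.

Lemma dyadic_step n a : `|a.+1%:R / 2 ^+ n - a%:R / 2 ^+ n| = 2 ^- n :> R.
Proof.
by rewrite -mulrBl -natr1 addrAC subrr add0r mul1r ger0_norm.
Qed.

Lemma normc_trap_le g p q (B D : R) : normc (g p) <= B -> normc (g q) <= B ->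
  normc (q - p) <= D -> normc (trap g p q) <= D * B.
Proof.
move=> hp hq hD; rewrite /trap normcM; apply: ler_pM; rewrite ?normc_ge0 //.
have -> : (g p + g q) / 2 = (g p + g q) * (2^-1)%:C.
  by rewrite fmorphV rmorph_nat.
rewrite normcM normc_real ger0_norm ?invr_ge0 // ler_pdivrMr //.
by apply: le_trans (normcD_le _ _) _; rewrite mulr_natr mulr2n lerD.
Qed.

Lemma normc_vsum_le g n a b l (B D : R) :
  (forall x, (b <= x <= b + l)%N -> normc (g (grid n a x)) <= B) ->
  (forall x, (b <= x < b + l)%N -> normc (grid n a x.+1 - grid n a x) <= D) ->
  normc (vsum g n a b l) <= l%:R * (D * B).
Proof.
move=> hB hD; apply: le_trans (normc_sum _ _ _ _) _.
have -> : l%:R * (D * B) = \sum_(k < l) (D * B).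
  by rewrite sumr_const card_ord mulr_natl.
apply: ler_sum => k _.
have kl := ltn_ord k.
apply: normc_trap_le.
- by apply: hB; rewrite leq_addr leq_add2l ltnW.
- by apply: hB; rewrite -addnS leq_addr leq_add2l.
- by apply: hD; rewrite leq_addr ltn_add2l.
Qed.

Lemma normc_hsum_le g n a b l (B D : R) :
  (forall x, (a <= x <= a + l)%N -> normc (g (grid n x b)) <= B) ->
  (forall x, (a <= x < a + l)%N -> normc (grid n x.+1 b - grid n x b) <= D) ->
  normc (hsum g n a b l) <= l%:R * (D * B).
Proof.
move=> hB hD; apply: le_trans (normc_sum _ _ _ _) _.
have -> : l%:R * (D * B) = \sum_(k < l) (D * B).
  by rewrite sumr_const card_ord mulr_natl.
apply: ler_sum => k _.
have kl := ltn_ord k.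
apply: normc_trap_le.
- by apply: hB; rewrite leq_addr leq_add2l ltnW.
- by apply: hB; rewrite -addnS leq_addr leq_add2l.
- by apply: hD; rewrite leq_addr ltn_add2l.
Qed.

(** Four sides of l steps each, every step of length at most L / 2^n by the Lipschitz bound. *)
Lemma normc_square_sum_le h n a b l (B : R) :
  (a + l <= 2 ^ n)%N -> (b + l <= 2 ^ n)%N ->
  (forall x y, (a <= x <= a + l)%N -> (b <= y <= b + l)%N ->
     normc (h (grid n x y)) <= B) ->
  normc (square_sum h n a b l) <= 4 * (l%:R * (L * 2 ^- n * B)).
Proof.
move=> al bl hB.
have hD x y : (x < 2 ^ n)%N -> (y <= 2 ^ n)%N ->
    normc (grid n x.+1 y - grid n x y) <= L * 2 ^- n.
  move=> hx hy; have h1 := dyadic01 n x.+1 hx.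
  have h2 := dyadic01 n x (ltnW hx); have h3 := dyadic01 n y hy.
  apply: le_trans (lip _ _ _ _ h1 h3 h2 h3) _.
  by rewrite subrr normr0 addr0 dyadic_step.
have hD' x y : (x <= 2 ^ n)%N -> (y < 2 ^ n)%N ->
    normc (grid n x y.+1 - grid n x y) <= L * 2 ^- n.
  move=> hx hy; have h1 := dyadic01 n y.+1 hy.
  have h2 := dyadic01 n y (ltnW hy); have h3 := dyadic01 n x hx.
  apply: le_trans (lip _ _ _ _ h3 h1 h3 h2) _.
  by rewrite subrr normr0 add0r dyadic_step.
have al' : (a <= 2 ^ n)%N by exact: leq_trans (leq_addr _ _) al.
have bl' : (b <= 2 ^ n)%N by exact: leq_trans (leq_addr _ _) bl.
have h1 : normc (hsum h n a b l) <= l%:R * (L * 2 ^- n * B).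
  apply: normc_hsum_le => x /andP[x1 x2]; first by rewrite hB ?x1 // leqnn leq_addr.
  by apply: hD => //; exact: leq_trans al.
have h2 : normc (hsum h n a (b + l) l) <= l%:R * (L * 2 ^- n * B).
  apply: normc_hsum_le => x /andP[x1 x2]; first by rewrite hB ?x1 // leqnn leq_addr.
  by apply: hD => //; exact: leq_trans al.
have h3 : normc (vsum h n a b l) <= l%:R * (L * 2 ^- n * B).
  apply: normc_vsum_le => x /andP[x1 x2]; first by rewrite hB ?x1 // leqnn leq_addr.
  by apply: hD' => //; exact: leq_trans bl.
have h4 : normc (vsum h n (a + l) b l) <= l%:R * (L * 2 ^- n * B).
  apply: normc_vsum_le => x /andP[x1 x2]; first by rewrite hB ?x1 // leqnn leq_addr.
  by apply: hD' => //; exact: leq_trans bl.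
rewrite /square_sum.
have k1 := normcB_le (hsum h n a b l + vsum h n (a + l) b l - hsum h n a (b + l) l) (vsum h n a b l).
have k2 := normcB_le (hsum h n a b l + vsum h n (a + l) b l) (hsum h n a (b + l) l).
have k3 := normcD_le (hsum h n a b l) (vsum h n (a + l) b l).
apply: (le_trans k1); apply: le_trans (lerD k2 h3) _.
by have := lerD (lerD (lerD k3 (lexx 0)) h2) (lerD h1 h4); lra.
Qed.

End Trapezoid.

(** The supremum of the left ends lies in every interval of the nested sequence. Applied to each
    coordinate, it gives the point to which the cells shrink. *)
Lemma nested_dyadic (R : realType) (i : nat -> nat) : i 0%N = 0%N ->
  (forall m, exists b : bool, i m.+1 = ((i m).*2 + b)%N) ->
  exists2 s : R, 0 <= s <= 1 & forall m,
    [/\ (i m < 2 ^ m)%N, (i m)%:R / 2 ^+ m <= s & s <= (i m).+1%:R / 2 ^+ m].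
Proof.
move=> i0 iS.
pose x m : R := (i m)%:R / 2 ^+ m.
pose y m : R := (i m).+1%:R / 2 ^+ m.
have xS m : x m <= x m.+1 /\ y m.+1 <= y m.
  have [b hb] := iS m; rewrite /x /y hb exprS.
  have p0 : 0 < 2 ^+ m :> R by rewrite exprn_gt0.
  have e2 (a : R) : a / 2 ^+ m = (2 * a) / (2 * 2 ^+ m).
    by rewrite -mulf_div divff // mul1r.
  rewrite !(e2 (_%:R)) !ler_pM2r ?invr_gt0 ?mulr_gt0 // -!natrM !ler_nat.
  by rewrite !mul2n; case: b {hb}; rewrite ?addn0 ?addn1 ?doubleS; split => //; exact: ltnW.
have xy m : x m <= y m.
  by rewrite /x /y ler_pM2r ?ler_nat // invr_gt0 exprn_gt0.
have xm k m : x m <= x (m + k)%N /\ y (m + k)%N <= y m.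
  elim: k => [|k [IH1 IH2]]; first by rewrite addn0.
  rewrite addnS; have [h1 h2] := xS (m + k)%N.
  by split; [exact: le_trans h1|exact: le_trans IH2].
have xyn m n : x m <= y n.
  have [/subnKC h|/ltnW/subnKC h] := leqP m n.
    by apply: le_trans (xy n); rewrite -h; have [] := xm (n - m)%N m.
  by apply: le_trans (xy m) _; rewrite -h; have [] := xm (m - n)%N n.
pose E := [set x m | m in [set: nat]].
have E0 : E !=set0 by exists (x 0%N), 0%N.
have ubE n : ubound E (y n) by move=> _ [m _ <-].
have hE : has_sup E by split => //; exists (y 0%N).
have up m : x m <= sup E by apply: ub_le_sup; [exists (y 0%N)|exists m].
have dn m : sup E <= y m by apply: ge_sup.
exists (sup E) => [|m]; last first.
  split; rewrite ?up ?dn //.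
  elim: m => [|m IH]; first by rewrite i0.
  have [b ->] := iS m; rewrite expnS mul2n.
  by case: b; rewrite ?addn0 ?addn1 ?ltn_Sdouble ?ltn_double.
have := up 0%N; have := dn 0%N.
by rewrite /x /y i0 expr0 !divr1 => -> ->.
Qed.

Lemma exists_exp2_gt (R : realType) (C : R) : exists m : nat, C < 2 ^+ m.
Proof.
exists (Num.bound C); have [C0|C0] := leP 0 C; last first.
  by apply: lt_le_trans C0 _; rewrite exprn_ge0.
apply: lt_le_trans (archi_boundP C0) _.
by rewrite -natrX ler_nat ltnW // ltn_expl.
Qed.

(** * The bisection argument on dyadic cells *)

Section Goursat.
Context {R : realType}.
Variables (Phi : R -> R -> R[i]) (L : R) (g : R[i] -> R[i]).
Hypothesis lip : forall s t s' t' : R,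
  0 <= s <= 1 -> 0 <= t <= 1 -> 0 <= s' <= 1 -> 0 <= t' <= 1 ->
  normc (Phi s t - Phi s' t') <= L * (`|s - s'| + `|t - t'|).
Hypothesis diffg : forall s t : R, 0 <= s <= 1 -> 0 <= t <= 1 ->
  complex_diff g (Phi s t).

Let cell m d (ij : nat * nat) :=
  square_sum Phi g (m + d) (ij.1 * 2 ^ d) (ij.2 * 2 ^ d) (2 ^ d).

Variable e : R.

(* [cell m d ij] is the boundary sum of the dyadic cell ij of generation m,
   with its sides cut into 2 ^ d pieces. Bisection works with the limit superior
   over d in place of an integral, since it is subadditive on the four quarters *)
Let large m ij := forall n0, exists2 d, (n0 <= d)%N &
  e / 4 ^+ m < normc (cell m d ij).

(** The total depth m + d + 1 is common to all five sums, so they live on one grid. *)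
Let cell_quarter m d i j : cell m d.+1 (i, j) =
  cell m.+1 d (i.*2, j.*2) + cell m.+1 d (i.*2.+1, j.*2) +
  cell m.+1 d (i.*2, j.*2.+1) + cell m.+1 d (i.*2.+1, j.*2.+1).
Proof.
have h k : (k * 2 ^ d.+1 = k.*2 * 2 ^ d)%N by rewrite expnS mulnA muln2.
have h' k : (k.*2.+1 * 2 ^ d = k.*2 * 2 ^ d + 2 ^ d)%N by rewrite mulSn addnC.
rewrite /cell /= !h !h' expnS mul2n -[(2 ^ d).*2%N]addnn addSnnS.
by rewrite square_sum_quarter.
Qed.

(** If all four quarters were eventually at most e / 4^(m+1), their sum would eventually be at most
    e / 4^m. *)
Let large_quarter m ij : large m ij -> exists2 kl, large m.+1 kl &
  (exists b : bool, kl.1 = (ij.1.*2 + b)%N) /\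
  (exists b : bool, kl.2 = (ij.2.*2 + b)%N).
Proof.
case: ij => i j hl; apply: contrapT => hN.
have small (b b' : bool) : exists n0, forall d, (n0 <= d)%N ->
    normc (cell m.+1 d (i.*2 + b, j.*2 + b')%N) <= e / 4 ^+ m.+1.
  apply: contrapT => h; apply: hN; exists (i.*2 + b, j.*2 + b')%N; last first.
    by split; [exists b|exists b'].
  move=> n0; apply: contrapT => h'; apply: h; exists n0 => d hd.
  by rewrite leNgt; apply/negP => h''; apply: h'; exists d.
have [n1 h1] := small false false; have [n2 h2] := small true false.
have [n3 h3] := small false true; have [n4 h4] := small true true.
(* One above the four thresholds: a cell with 2^(d+1) pieces per side splits into quarters with
   2^d. *)
have [[//|d]] := hl (maxn (maxn n1 n2) (maxn n3 n4)).+1.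
rewrite ltnS !geq_max => /andP[/andP[d1 d2] /andP[d3 d4]].
apply/negP; rewrite -leNgt cell_quarter.
have := h1 d d1; have := h2 d d2; have := h3 d d3; have := h4 d d4.
rewrite !addn0 !addn1 => k4 k3 k2 k1.
apply: le_trans (normcD_le _ _) _; apply: le_trans (lerD (normcD_le _ _) (lexx _)) _.
apply: le_trans (lerD (lerD (normcD_le _ _) (lexx _)) (lexx _)) _.
have := lerD (lerD k1 k2) (lerD k3 k4).
have -> : e / 4 ^+ m = 4 * (e / 4 ^+ m.+1).
  by rewrite exprS; field; rewrite expf_neq0.
lra.
Qed.

(** Large cells nested inside each other shrink to a point z. There the affine part of g has
    boundary sum 0, and the remainder is too small for the cell to be large. *)
Lemma not_large0 : 0 < e -> ~ large 0 (0, 0)%N.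
Proof.
move=> e0 large0.
have /choice[f fP] : forall mij : nat * (nat * nat), exists kl,
    large mij.1 mij.2 -> large mij.1.+1 kl /\
  (exists b : bool, kl.1 = (mij.2.1.*2 + b)%N) /\
  (exists b : bool, kl.2 = (mij.2.2.*2 + b)%N).
  move=> [m ij]; have [/large_quarter[kl h1 h2]|h] := pselect (large m ij).
    by exists kl.
  (* An arbitrary value at cells that are not large; the sequence [c] below meets only large
     ones. *)
  by exists (0, 0)%N.
pose c := fix c m := if m is m'.+1 then f (m', c m') else (0, 0)%N.
have cP m : large m (c m) by elim: m => // m IH; have [] := fP (m, c m) IH.
have [s s01 sP] := @nested_dyadic R (fun m => (c m).1) erefl
   (fun m => (fP (m, c m) (cP m)).2.1).
have [t t01 tP] := @nested_dyadic R (fun m => (c m).2) erefl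
   (fun m => (fP (m, c m) (cP m)).2.2).
have [d' dP] := diffg s t s01 t01.
(* The perimeter is at most 4 L / 2^m and the distance to z at most 2 L / 2^m, whence 8 L^2; the 1
   keeps [K] positive and the final ratio below 1. *)
pose K := 8 * L ^+ 2 + 1.
have K0 : 0 < K by rewrite ltr_wpDl // mulr_ge0 // sqr_ge0.
have [eta eta0 etaP] := dP (e / K) (divr_gt0 e0 K0).
(* From this generation on the cell lies within eta of z. *)
have [m hm] := exists_exp2_gt R (2 * L / eta).
have p0 : 0 < 2 ^+ m :> R by rewrite exprn_gt0.
have [d _] := cP m 0%N; apply/negP; rewrite -leNgt.
have := sP m; have := tP m; case: (c m) => i j /= [jm t1 t2] [im s1 s2].
rewrite /cell /=; set z := Phi s t.
have L0 : 0 <= L.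
  have := lip 1 0 0 0; rewrite !lexx !ler01 subr0 subrr normr0 addr0 normr1 mulr1.
  by move=> /(_ isT isT isT isT); apply: le_trans; exact: normc_ge0.
have pd0 : 0 < 2 ^+ d :> R by rewrite exprn_gt0.
have cell_pt k x (u : R) : (k * 2 ^ d <= x <= k * 2 ^ d + 2 ^ d)%N ->
    k%:R / 2 ^+ m <= u -> u <= k.+1%:R / 2 ^+ m ->
    `|x%:R / 2 ^+ (m + d) - u| <= 2 ^- m.
  move=> /andP[x1 x2] u1 u2.
  have h1 : k%:R / 2 ^+ m <= x%:R / 2 ^+ (m + d) :> R.
    rewrite exprD invfM mulrA ler_pdivlMr // mulrAC ler_pM2r ?invr_gt0 //.
    by rewrite -natrX -natrM ler_nat.
  have h2 : x%:R / 2 ^+ (m + d) <= k.+1%:R / 2 ^+ m :> R.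
    rewrite exprD invfM mulrA ler_pdivrMr // mulrAC ler_pM2r ?invr_gt0 //.
    by rewrite -natrX -natrM ler_nat mulSn addnC.
  have h3 : k.+1%:R / 2 ^+ m = k%:R / 2 ^+ m + 2 ^- m :> R.
    by rewrite -natr1 mulrDl mul1r.
  by rewrite ler_norml; move: h1 h2 u1 u2; rewrite h3; lra.
have cell_le k : (k < 2 ^ m)%N -> (k * 2 ^ d + 2 ^ d <= 2 ^ (m + d))%N.
  by move=> km; rewrite addnC -mulSn expnD leq_mul2r km orbT.
(* Subtracting the first-order expansion at z leaves the boundary sum unchanged. *)
pose h w := g w - ((g z - d' * z) + d' * w).
have -> : square_sum Phi g (m + d) (i * 2 ^ d) (j * 2 ^ d) (2 ^ d) =
    square_sum Phi h (m + d) (i * 2 ^ d) (j * 2 ^ d) (2 ^ d).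
  by rewrite square_sumB square_sum_affine subr0.
have hB x y : (i * 2 ^ d <= x <= i * 2 ^ d + 2 ^ d)%N ->
    (j * 2 ^ d <= y <= j * 2 ^ d + 2 ^ d)%N ->
    normc (h (grid Phi (m + d) x y)) <= e / K * (2 * L / 2 ^+ m).
  move=> hx hy; set w := grid _ _ _ _.
  have hw : normc (w - z) <= 2 * L / 2 ^+ m.
    apply: le_trans (lip _ _ _ _ _ _ _ _) _ => //.
    - by apply: dyadic01; case/andP: hx => _ /leq_trans; apply; exact: cell_le.
    - by apply: dyadic01; case/andP: hy => _ /leq_trans; apply; exact: cell_le.
    rewrite -mulrA mulrCA; apply: ler_wpM2l => //.
    have := lerD (cell_pt i x s hx s1 s2) (cell_pt j y t hy t1 t2).
    by rewrite [2 * _]mulr_natl mulr2n.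
  have hw' : normc (w - z) < eta.
    apply: le_lt_trans hw _; rewrite ltr_pdivrMr //.
    by move: hm; rewrite ltr_pdivrMr // [eta * _]mulrC.
  apply: le_trans (_ : e / K * normc (w - z) <= _); last first.
    by apply: ler_wpM2l hw; rewrite divr_ge0 // ltW.
  have -> : h w = g w - g z - d' * (w - z) by rewrite /h; ring.
  exact: etaP.
apply: le_trans (normc_square_sum_le _ _ lip _ _ _ _ _ _ (cell_le i im) (cell_le j jm) hB) _.
have -> : (4 : R) ^+ m = 2 ^+ m * 2 ^+ m by rewrite -exprMn -natrM.
have -> : 4 * ((2 ^ d)%N%:R * (L * 2 ^- (m + d) * (e / K * (2 * L / 2 ^+ m)))) =
   (8 * L ^+ 2 / K) * (e / (2 ^+ m * 2 ^+ m)).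
  by rewrite natrX exprD; field; rewrite !gt_eqF.
apply: ler_piMl; first by rewrite divr_ge0 ?mulr_ge0 ?ltW.
by rewrite ler_pdivrMr // mul1r /K lerDl.
Qed.

End Goursat.

Lemma square_sum_cvg0 (R : realType) (Phi : R -> R -> R[i]) (L : R)
    (g : R[i] -> R[i]) :
  (forall s t s' t' : R,
    0 <= s <= 1 -> 0 <= t <= 1 -> 0 <= s' <= 1 -> 0 <= t' <= 1 ->
    normc (Phi s t - Phi s' t') <= L * (`|s - s'| + `|t - t'|)) ->
  (forall s t : R, 0 <= s <= 1 -> 0 <= t <= 1 -> complex_diff g (Phi s t)) ->
  forall e : R, 0 < e -> exists n0, forall n, (n0 <= n)%N ->
    normc (square_sum Phi g n 0 0 (2 ^ n)) <= e.
Proof.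
move=> lip diffg e e0; apply: contrapT => h.
have := not_large0 _ _ _ lip diffg _ e0; apply => n0; apply: contrapT => h'; apply: h.
exists n0 => n hn; rewrite leNgt; apply/negP => h''; apply: h'.
by exists n => //; rewrite expr0 divr1.
Qed.

(** * Complex differentiability in terms of real moduli *)

Section ComplexDifferentiability.
Context {R : realType}.

(** This turns the complex radii and tolerances of the topology of [R[i]] into real ones. *)
Lemma gtc0_real (e : R[i]) : 0 < e -> e = (complex.Re e)%:C /\ 0 < complex.Re e.
Proof. by case: e => a b; rewrite ltcE /= => /andP[/eqP -> ?]. Qed.

Lemma normc_gt0 (z : R[i]) : z != 0 -> 0 < normc z.
Proof.
move=> z0; rewrite lt_neqAle (normc_ge0 z) andbT eq_sym.
by apply: contra_neq z0 => /eq0_normc.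
Qed.

Lemma complex_diffP (g : R[i] -> R[i]) (z : R[i]) :
  derivable (g : R[i]^o -> R[i]^o) z 1 <-> complex_diff g z.
Proof.
split=> [/cvg_ex[d] /cvgrPdist_lt hd|[d hd]].
  exists d => e e0.
  have e0' : 0 < e%:C :> R[i] by rewrite ltcR.
  have /nbhs_ballP[/= eta /gtc0_real[-> eta0] hball] := hd _ e0'.
  exists (complex.Re eta) => // w hw.
  have [->|wz] := eqVneq w z; first by rewrite !subrr mulr0 subrr normc0 mulr0.
  have h0 : w - z != 0 by rewrite subr_eq0.
  have := hball (w - z); rewrite /ball /= sub0r normrN !normr_normc ltcR.
  move=> /(_ hw h0); rewrite [_ *: 1]mulr1 subrK ltcR => /ltW h.
  have -> : g w - g z - d * (w - z) = - ((w - z) * (d - (w - z)^-1 *: (g w - g z))).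
    by rewrite [_ *: _]/GRing.scale /=; field.
  by rewrite normcN normcM mulrC; apply: ler_wpM2r => //; exact: normc_ge0.
apply/cvg_ex; exists d; apply/cvgrPdist_le => eps /gtc0_real[epsE e0].
have [eta eta0 h] := hd _ e0.
apply/nbhs_ballP; exists eta%:C; rewrite /= ?ltcR // => w.
rewrite /ball /= sub0r normrN !normr_normc ltcR => hw w0.
rewrite [_ *: 1]mulr1 epsE lecR.
have := h (w + z); rewrite addrK => /(_ hw).
have -> : d - w^-1 *: (g (w + z) - g z) = - (w^-1 * (g (w + z) - g z - d * w)).
  by rewrite [_ *: _]/GRing.scale /=; field.
rewrite normcN normcM normcV => h'.
rewrite (ler_pdivrMl _ _ (normc_gt0 w w0)) [X in _ <= X]mulrC.
exact: h'.
Qed.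

Lemma complex_diff_quot (f : R[i] -> R[i]) (x z : R[i]) : z != x ->
  complex_diff f z -> complex_diff (fun w => (f w - f x) / (w - x)) z.
Proof.
move=> zx /complex_diffP df; apply/complex_diffP.
pose u : R[i]^o -> R[i]^o := (f : R[i]^o -> R[i]^o) - cst (f x : R[i]^o).
pose v : R[i]^o -> R[i]^o := (id : R[i]^o -> R[i]^o) - cst (x : R[i]^o).
have hu : derivable u z 1.
  exact: (@derivableB _ _ _ _ _ _ _ df (@derivable_cst _ _ _ _ _ _)).
have hv : derivable v z 1.
  exact: (@derivableB _ _ _ _ _ _ _ (@derivable_id _ _ _ _) (@derivable_cst _ _ _ _ _ _)).
have v0 : v z != 0 by rewrite /v subr_eq0.
have hw := @derivableV _ _ v z 1 v0 hv.
have huw := @derivableM _ _ u _ z 1 hu hw.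
have -> : (fun w => (f w - f x) / (w - x)) = u * (fun w : R[i]^o => (v w)^-1 : R[i]^o).
  by apply/funext => w.
exact: huw.
Qed.

(** The expansion with tolerance 1 suffices. It bounds the difference quotient of f near x. *)
Lemma complex_diff_lipschitz (f : R[i] -> R[i]) (x : R[i]) :
  complex_diff f x -> exists K : R, exists2 eta : R, 0 < eta &
    forall w, normc (w - x) < eta -> normc (f w - f x) <= K * normc (w - x).
Proof.
move=> [d /(_ 1 ltr01)[eta eta0 h]]; exists (1 + normc d), eta => // w hw.
have -> : f w - f x = (f w - f x - d * (w - x)) + d * (w - x) by rewrite subrK.
apply: le_trans (normcD_le _ _) _; rewrite normcM mulrDl lerD2r.
exact: h.
Qed.

End ComplexDifferentiability.

(** * Roots of unity and the discrete Cauchy formula *)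

Section Circle.
Context {R : realType}.

Lemma ler_dist_of_derive (f df : R -> R) (a b : R) :
  (forall x : R, is_derive x (1 : R) f (df x)) -> (forall x, `|df x| <= 1) ->
  `|f a - f b| <= `|a - b|.
Proof.
move=> hd h1; wlog ab : a b / a <= b => [hw|].
  have [/hw//|/ltW/hw] := leP a b.
  by rewrite distrC [X in _ <= X]distrC.
have [|x _ fx] := @MVT_segment R f df a b ab (fun x _ => hd x).
  apply: continuous_subspaceT => x; apply: differentiable_continuous.
  by apply/derivable1_diffP; case: (hd x).
by rewrite distrC fx normrM [X in _ <= X]distrC ler_piMl.
Qed.

(** e^(2 pi i t): the parameter counts full turns, so dyadic t give roots of unity of order a power
    of 2. *)
Definition cis (t : R) : R[i] := cos (2 * pi * t) +i* sin (2 * pi * t).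

Lemma cisD s t : cis (s + t) = cis s * cis t.
Proof.
rewrite /cis mulrDr cosD sinD; apply/eqP; rewrite eq_complex /=.
by rewrite eqxx /= addrC eqxx.
Qed.

Lemma cis0 : cis 0 = 1 :> R[i].
Proof. by rewrite /cis mulr0 cos0 sin0. Qed.

Lemma cis1 : cis 1 = 1 :> R[i].
Proof. by rewrite /cis mulr1 mulr_natl cos2pi sin2pi. Qed.

Lemma cis_half : cis 2^-1 = -1 :> R[i].
Proof.
rewrite /cis mulrAC divff // mul1r cospi sinpi.
by apply/eqP; rewrite eq_complex /= oppr0 !eqxx.
Qed.

Lemma normc_cis t : normc (cis t) = 1.
Proof. by rewrite /cis /= cos2Dsin2 sqrtr1. Qed.

Lemma cis_neq0 t : cis t != 0.
Proof.
by apply/eqP => h; have := normc_cis t; rewrite h normc0 => /esym/eqP; rewrite oner_eq0.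
Qed.

Lemma cis_natM (t : R) k : cis (k%:R * t) = cis t ^+ k.
Proof.
elim: k => [|k IH]; first by rewrite mul0r cis0.
by rewrite -natr1 mulrDl mul1r cisD IH exprSr.
Qed.

Lemma normc_le_abs (a b : R) : normc (a +i* b) <= `|a| + `|b|.
Proof.
have -> : a +i* b = a%:C + 'i * b%:C by exact: complexE.
apply: le_trans (normcD_le _ _) _; rewrite normcM !normc_real.
by rewrite /= expr0n expr1n add0r sqrtr1 mul1r.
Qed.

(** The mean value theorem in each coordinate; adding the two costs a factor 2 over the arc
    length. *)
Lemma normc_cisB s t : normc (cis s - cis t) <= 4 * pi * `|s - t|.
Proof.
have pi0 := pi_ge0 R.
have e0 : `|2 * pi * s - 2 * pi * t| = 2 * pi * `|s - t|.
  by rewrite -mulrBr normrM ger0_norm // mulr_ge0.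
have h1 : `|cos (2 * pi * s) - cos (2 * pi * t)| <= 2 * pi * `|s - t|.
  rewrite -e0; apply: (@ler_dist_of_derive cos (fun x => - sin x)) => x.
  by rewrite normrN sin_max.
have h2 : `|sin (2 * pi * s) - sin (2 * pi * t)| <= 2 * pi * `|s - t|.
  rewrite -e0; apply: (@ler_dist_of_derive sin cos) => x.
  by rewrite cos_max.
apply: le_trans (normc_le_abs _ _) _.
by have := lerD h1 h2; lra.
Qed.

Definition unity_root n : R[i] := cis (2 ^- n).

Lemma cis_dyadic n k : cis (k%:R / 2 ^+ n) = unity_root n ^+ k :> R[i].
Proof. exact: cis_natM. Qed.

Lemma unity_root_exp n : unity_root n ^+ (2 ^ n) = 1 :> R[i].
Proof. by rewrite -cis_dyadic natrX divff ?cis1 // expf_neq0. Qed.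

Lemma unity_root_half n : unity_root n.+1 ^+ (2 ^ n) = -1 :> R[i].
Proof.
by rewrite -cis_dyadic natrX exprS invfM mulrCA divff ?mulr1 ?cis_half.
Qed.

(** For odd j, w^j = 1 would give (-1)^j = 1 on raising to the power 2^n; for even j, pass to w^2
    and j / 2. *)
Lemma expr_neq1_of_halfN1 (w : R[i]) n j : w ^+ (2 ^ n) = -1 ->
  (0 < j < 2 ^ n.+1)%N -> w ^+ j != 1.
Proof.
have N11 : (-1 : R[i]) != 1 by rewrite eq_sym -addr_eq0 -mulr2n pnatr_eq0.
elim: n w j => [|n IH] w j hw /andP[j0 jn].
  have -> : j = 1%N by case: j j0 jn => // -[].
  by rewrite hw.
have [/even_halfK jE|jo] := boolP (~~ odd j).
  rewrite -jE -muln2 mulnC exprM; apply: IH; first by rewrite -exprM -expnS.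
  rewrite -double_gt0 jE j0 -ltn_double jE -mul2n -expnS; exact: jn.
apply/eqP => h; have := congr1 (fun u => u ^+ (2 ^ n.+1)) h.
rewrite /= expr1n -exprM mulnC exprM hw -signr_odd.
by move: jo; rewrite negbK => -> /=; rewrite expr1 => /eqP; rewrite (negPf N11).
Qed.

Lemma unity_root_sum n j : (0 < j < 2 ^ n)%N ->
  \sum_(k < 2 ^ n) unity_root n ^+ (j * k) = 0 :> R[i].
Proof.
case: n => [|n] hj; first by case: j hj => // -[].
have hne := expr_neq1_of_halfN1 _ _ _ (unity_root_half n) hj.
set y := unity_root n.+1 ^+ j in hne *.
have y1 : y - 1 != 0 by rewrite subr_eq0.
apply: (mulfI y1); rewrite mulr0.
under eq_bigr do rewrite exprM -/y.
by rewrite -subrX1 /y -exprM mulnC exprM unity_root_exp expr1n subrr.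
Qed.

(* (w ^+ 2) ^+ (2 ^ n) = -1 is at distance 2 from 1, and each of the 2 ^ n steps
   moves by |w ^+ 2 - 1| *)
Lemma unity_root_sq_lower n : 2 / 2 ^+ n <= normc (unity_root n.+2 ^+ 2 - 1 : R[i]).
Proof.
set w : R[i] := unity_root n.+2.
have w1 : normc (w ^+ 2) <= 1 by rewrite normcX normc_cis expr1n.
have n1 : normc 1 <= (1 : R) by rewrite normc1.
have := normc_subX_le 1 (w ^+ 2) 1 (2 ^ n).-1 w1 n1.
rewrite prednK ?expn_gt0 // !expr1n mulr1 -exprM -expnS unity_root_half.
have -> : normc (-1 - 1 : R[i]) = 2 :> R.
  by rewrite -opprD normcN -[1 + 1]/(2%:R) normc_nat.
by rewrite ler_pdivrMr ?exprn_gt0 // mulrC -natrX.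
Qed.

End Circle.

(** * Contraction of a circle to an interior point, and Fourier interpolation *)

Section DiscreteCauchy.
Context {R : realType}.
Variables (f : R[i] -> R[i]) (c : R[i]) (r : R).
Hypothesis r0 : 0 < r.
Hypothesis diff_f : forall z, normc (z - c) <= r -> complex_diff f z.

Definition circ (t : R) : R[i] := c + r%:C * cis t.

Lemma circB t : circ t - c = r%:C * cis t.
Proof. by rewrite /circ addrAC subrr add0r. Qed.

Lemma normc_circB t : normc (circ t - c) = r.
Proof. by rewrite circB normcM normc_real normc_cis mulr1 gtr0_norm. Qed.

Lemma normc_circ_dist s t : normc (circ s - circ t) <= 4 * pi * r * `|s - t|.
Proof.
have -> : circ s - circ t = r%:C * (cis s - cis t) by rewrite /circ; ring.
rewrite normcM normc_real gtr0_norm //.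
by have := ler_wpM2l (ltW r0) (normc_cisB s t); lra.
Qed.

Section Point.
Variable x : R[i].
Hypothesis hx : normc (x - c) < r.

Let g z := (f z - f x) / (z - x).

Lemma normc_circ_ge t : r - normc (x - c) <= normc (circ t - x).
Proof.
have -> : circ t - x = (circ t - c) - (x - c) by ring.
have := normcD_le ((circ t - c) - (x - c)) (x - c).
by rewrite subrK normc_circB lerBlDr.
Qed.

Lemma normc_circ_le t : normc (circ t - x) <= 2 * r.
Proof.
have -> : circ t - x = (circ t - c) - (x - c) by ring.
apply: le_trans (normcB_le _ _) _; rewrite normc_circB.
by have := lerD (lexx r) (ltW hx); lra.
Qed.

(* Homotopy from the circle of radius r to its image of ratio d centred at x;
   it avoids x, so g is differentiable along it *)
Let Phi (d s t : R) := x + (d + (1 - d) * s)%:C * (circ t - x).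

(** Varying s moves along a segment of length at most 2 r; varying t moves along a circle of radius
    at most r. *)
Let Phi_lip (d : R) : 0 <= d <= 1 -> forall s t s' t' : R,
  0 <= s <= 1 -> 0 <= t <= 1 -> 0 <= s' <= 1 -> 0 <= t' <= 1 ->
  normc (Phi d s t - Phi d s' t') <=
    (2 * r + 4 * pi * r) * (`|s - s'| + `|t - t'|).
Proof.
move=> /andP[d0 d1] s t s' t' hs ht /andP[s0 s1] ht'.
have -> : Phi d s t - Phi d s' t' = ((1 - d) * (s - s'))%:C * (circ t - x) +
    (d + (1 - d) * s')%:C * (circ t - circ t').
  by rewrite /Phi !(rmorphD, rmorphM, rmorphB) /=; ring.
apply: le_trans (normcD_le _ _) _; rewrite !normcM !normc_real.
have h1 : `|(1 - d) * (s - s')| * normc (circ t - x) <= `|s - s'| * (2 * r).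
  apply: ler_pM => //; [exact: normc_ge0| |exact: normc_circ_le].
  rewrite normrM ler_piMl // ger0_norm ?subr_ge0 //; lra.
have h2 : `|d + (1 - d) * s'| * normc (circ t - circ t') <=
    1 * (4 * pi * r * `|t - t'|).
  apply: ler_pM => //; [exact: normc_ge0| |exact: normc_circ_dist].
  have k0 : 0 <= (1 - d) * s' by rewrite mulr_ge0 // subr_ge0.
  rewrite ger0_norm ?addr_ge0 //.
  by have := ler_wpM2l (_ : 0 <= 1 - d) s1; rewrite subr_ge0 => /(_ d1); lra.
have k1 : 0 <= pi * r * `|s - s'| by rewrite !mulr_ge0 ?pi_ge0 // ltW.
have k2 : 0 <= r * `|t - t'| by rewrite mulr_ge0 // ltW.
by have := lerD h1 h2; lra.
Qed.

(** The point is a convex combination of x and a circle point with positive weight on the latter: it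
    stays in the closed disc and differs from x. *)
Let Phi_diff (d : R) : 0 < d <= 1 -> forall s t : R,
  0 <= s <= 1 -> 0 <= t <= 1 -> complex_diff g (Phi d s t).
Proof.
move=> /andP[d0 d1] s t /andP[s0 s1] _.
set A := d + (1 - d) * s.
have k0 : 0 <= (1 - d) * s by rewrite mulr_ge0 // subr_ge0.
have A0 : 0 < A by rewrite ltr_wpDr.
have A1 : A <= 1.
  by have := ler_wpM2l (_ : 0 <= 1 - d) s1; rewrite subr_ge0 => /(_ d1); rewrite /A; lra.
apply: complex_diff_quot.
  rewrite -subr_eq0 /Phi -/A addrAC subrr add0r mulf_neq0 //.
    by apply/eqP => /complexI /eqP; rewrite gt_eqF.
  apply/eqP => h; have := normc_circ_ge t; rewrite h normc0 leNgt.
  by rewrite subr_gt0 hx.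
apply: diff_f.
have -> : Phi d s t - c = (1 - A)%:C * (x - c) + A%:C * (circ t - c).
  by rewrite /Phi -/A rmorphB rmorph1; ring.
apply: le_trans (normcD_le _ _) _.
rewrite !normcM normc_circB !normc_real !ger0_norm ?subr_ge0 ?(ltW A0) //.
have := ler_wpM2l (_ : 0 <= 1 - A) (ltW hx); rewrite subr_ge0 => /(_ A1) h.
by apply: le_trans (lerD h (lexx _)) _; rewrite -mulrDl subrK mul1r.
Qed.

(** On the boundary of the homotopy the sides t = 0 and t = 1 coincide and cancel. The outer sum is
    thus a Goursat sum plus the sum over the small circle, whose length is O(d) while g is bounded
    near x. *)
Lemma circle_trap_cvg0 (e : R) : 0 < e -> exists n0, forall n, (n0 <= n)%N ->
  normc (\sum_(k < 2 ^ n) trap g (circ (k%:R / 2 ^+ n)) (circ (k.+1%:R / 2 ^+ n))) <= e.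
Proof.
move=> e0.
have [|K [eta eta0 hK]] := complex_diff_lipschitz f x.
  by apply: diff_f; exact: ltW.
have {hK} [K0 hK] : 0 <= Num.max K 0 /\ forall w, normc (w - x) < eta ->
    normc (f w - f x) <= Num.max K 0 * normc (w - x).
  split; first by rewrite le_max lexx orbT.
  move=> w /hK; move=> /le_trans; apply; rewrite ler_wpM2r ?normc_ge0 //.
  by rewrite le_max lexx.
move: (Num.max K 0) K0 hK => {}K K0 hK.
have p0 := pi_gt0 R.
pose C := 4 * pi * r * K + 1.
have C0 : 0 < C by rewrite ltr_wpDl // !mulr_ge0 // ltW.
(* The bound eta / (4 r) keeps the small circle within eta of x, and e / 2 / C makes its sum at most
   e / 2. *)
pose d := Num.min 1 (Num.min (eta / (4 * r)) (e / 2 / C)).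
have d0 : 0 < d.
  by rewrite !lt_min ltr01 !divr_gt0 ?mulr_gt0.
have d1 : d <= 1 by rewrite ge_min lexx.
have d2 : d * (2 * r) < eta.
  have : d <= eta / (4 * r) by rewrite !ge_min lexx orbT.
  rewrite ler_pdivlMr ?mulr_gt0 // => h; have := mulr_gt0 d0 r0; lra.
have d3 : d * C <= e / 2.
  have : d <= e / 2 / C by rewrite !ge_min lexx !orbT.
  by rewrite ler_pdivlMr.
have dd : 0 <= d <= 1 by rewrite ltW.
have dd' : 0 < d <= 1 by rewrite d0.
have e2 : 0 < e / 2 by rewrite divr_gt0.
have [n0 hn0] := square_sum_cvg0 _ (Phi d) _ g (Phi_lip d dd) (Phi_diff d dd') _ e2.
exists n0 => n hn; have := hn0 n hn.
rewrite /square_sum !add0n.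
have -> : hsum (Phi d) g n 0 (2 ^ n) (2 ^ n) = hsum (Phi d) g n 0 0 (2 ^ n).
  apply: eq_bigr => k _; rewrite /grid natrX divff ?expf_neq0 // mul0r.
  by rewrite /Phi /circ cis0 cis1.
set O := vsum _ _ _ (2 ^ n) _ _; set I := vsum _ _ _ 0 _ _; set H := hsum _ _ _ _ _ _.
have -> : H + O - H - I = O - I by ring.
have -> : O = \sum_(k < 2 ^ n) trap g (circ (k%:R / 2 ^+ n)) (circ (k.+1%:R / 2 ^+ n)).
  apply: eq_bigr => k _; rewrite /grid natrX divff ?expf_neq0 // !add0n /Phi.
  have -> : d + (1 - d) * 1 = 1 by ring.
  by rewrite rmorph1 !mul1r ![x + _]addrC !subrK.
have hI : normc I <= e / 2.
  apply: le_trans (normc_vsum_le _ _ _ _ _ _ K (d * (4 * pi * r * 2 ^- n)) _ _) _.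
  - move=> k _; rewrite /grid mul0r /Phi mulr0 addr0.
    set t := _ / _; set w := _ + _.
    have wx : w - x = d%:C * (circ t - x) by rewrite /w addrAC subrr add0r.
    have hw : normc (w - x) < eta.
      rewrite wx normcM normc_real gtr0_norm //.
      by apply: le_lt_trans d2; rewrite ler_wpM2l ?(ltW d0) ?normc_circ_le.
    have w0 : 0 < normc (w - x).
      rewrite wx normcM normc_real gtr0_norm // mulr_gt0 //.
      by apply: lt_le_trans (normc_circ_ge t); rewrite subr_gt0.
    by rewrite /g normcM normcV ler_pdivrMr // hK.
  - move=> k _; rewrite /grid mul0r /Phi mulr0 addr0.
    set t := k%:R / _; set t' := _ / _.
    have -> : x + d%:C * (circ t' - x) - (x + d%:C * (circ t - x)) =
        d%:C * (circ t' - circ t) by ring.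
    rewrite normcM normc_real gtr0_norm // ler_wpM2l ?(ltW d0) //.
    by have := normc_circ_dist t' t; rewrite dyadic_step.
  have -> : (2 ^ n)%N%:R * (d * (4 * pi * r * 2 ^- n) * K) = d * (4 * pi * r * K).
    by rewrite natrX; field; rewrite expf_neq0.
  by apply: le_trans d3; rewrite ler_wpM2l ?(ltW d0) // /C lerDl.
set S := \sum_(k < _) _ => hS.
have -> : S = (S - I) + I by rewrite subrK.
by apply: le_trans (normcD_le _ _) _; have := lerD hS hI; lra.
Qed.

Lemma sum_shift_periodic N (F : nat -> R[i]) : F N = F 0%N ->
  \sum_(k < N) F k.+1 = \sum_(k < N) F k.
Proof.
move=> h; apply/eqP; rewrite -subr_eq0 -sumrB.
rewrite -(big_mkord xpredT (fun k => F k.+1 - F k)) telescope_sumr //.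
by rewrite h subrr.
Qed.

Let zeta n k := circ (k%:R / 2 ^+ n).

Let zetaB n k : zeta n k - c = r%:C * unity_root n ^+ k.
Proof. by rewrite circB cis_dyadic. Qed.

(** The k-th step equals (w - 1) (zeta_k - c) and also (w - 1) / w (zeta_(k+1) - c). Using one form
    at each end and shifting the index gives the factor (w - 1) (1 + 1 / w) / 2. *)
Lemma circle_trap_sum n :
  \sum_(k < 2 ^ n) trap g (zeta n k) (zeta n k.+1) =
  (unity_root n ^+ 2 - 1) / (2 * unity_root n) *
  \sum_(k < 2 ^ n) (zeta n k - c) * g (zeta n k).
Proof.
set w := unity_root n.
have w0 : w != 0 by exact: cis_neq0.
pose F k := (zeta n k - c) * g (zeta n k).
have FN : F (2 ^ n)%N = F 0%N.
  by rewrite /F /zeta natrX divff ?expf_neq0 // mul0r /circ cis0 cis1.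
have tE k : trap g (zeta n k) (zeta n k.+1) =
    (w - 1) / 2 * F k + (w - 1) / (2 * w) * F k.+1.
  rewrite /trap /F !zetaB -/w.
  have -> : zeta n k.+1 - zeta n k = (w - 1) * (r%:C * w ^+ k).
    have -> : zeta n k.+1 - zeta n k = (zeta n k.+1 - c) - (zeta n k - c) by ring.
    by rewrite !zetaB -/w exprS; ring.
  by rewrite exprS; field.
under eq_bigr do rewrite tE.
rewrite big_split /= -!mulr_sumr (sum_shift_periodic _ _ FN).
by rewrite -mulrDl; congr (_ * _); field.
Qed.

Lemma circle_average_cvg0 (e : R) : 0 < e -> exists n0, forall n, (n0 <= n)%N ->
  normc ((2 ^+ n)^-1 * \sum_(k < 2 ^ n) (zeta n k - c) * g (zeta n k)) <= e.
Proof.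
move=> e0; have [n0 hn0] := circle_trap_cvg0 e e0.
(* For n <= 1 the factor w^2 - 1 vanishes; from n = 2 on, the modulus of the whole prefactor is at
   least 1 / 2^n. *)
exists (maxn 2 n0) => n; rewrite geq_max => /andP[n2 hn].
have := hn0 n hn; rewrite -/(zeta n _) circle_trap_sum.
case: n n2 {hn} => [|[|n]] // _.
set w := unity_root n.+2; set S := \sum_(k < _) _.
have hw := @unity_root_sq_lower R n; rewrite -/w in hw.
rewrite !normcM !normcV normcM normc_cis mulr1 normcX.
have -> : normc 2 = 2 :> R by exact: normc_nat.
have S0 := normc_ge0 S.
move=> h; apply: le_trans h.
apply: ler_wpM2r => //.
rewrite ler_pdivlMr //; apply: le_trans hw.
rewrite 2!exprS; have p0 : 0 < 2 ^+ n :> R by rewrite exprn_gt0.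
rewrite !invfM.
have q0 : 0 <= (2 ^+ n)^-1 :> R by rewrite invr_ge0 ltW.
lra.
Qed.

(** Summing over j first gives the kernel (1 - Q) (zeta - c) / (zeta - x), whose average over the
    nodes is 1. Hence f x may be taken inside the average, and the error is 1 - Q times the average
    of (zeta - c) g(zeta). *)
Lemma circle_interpolation_cvg (e : R) : 0 < e ->
  exists n0, forall n, (n0 <= n)%N ->
  normc (\sum_(j < 2 ^ n) ((2 ^+ n)^-1 *
      \sum_(k < 2 ^ n) f (zeta n k) / (zeta n k - c) ^+ j) * (x - c) ^+ j - f x) <= e.
Proof.
move=> e0; have e2 : 0 < e / 2 by rewrite divr_gt0.
have [n0 hn0] := circle_average_cvg0 _ e2.
exists n0 => n /hn0; set N := (2 ^ n)%N => hn.
pose u k := (x - c) / (zeta n k - c).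
(* The N-th power of u k does not depend on k, since it removes the root of unity. *)
pose Q := ((x - c) / r%:C) ^+ N.
have z0 k : zeta n k - c != 0.
  by apply/eqP => h; have := normc_circB (k%:R / 2 ^+ n); rewrite h normc0 => /eqP; rewrite lt_eqF.
have zx k : zeta n k - x != 0.
  apply/eqP => h; have := normc_circ_ge (k%:R / 2 ^+ n).
  by rewrite -/(zeta n k) h normc0 leNgt subr_gt0 hx.
have N0 : (2 : R[i]) ^+ n != 0 by rewrite expf_neq0.
have r00 : r%:C != 0 by apply/eqP => /complexI/eqP; rewrite gt_eqF.
have geo k : \sum_(j < N) u k ^+ j = (1 - Q) * ((zeta n k - c) / (zeta n k - x)).
  have uN : u k ^+ N = Q.
    rewrite /u zetaB /Q !expr_div_n exprMn -exprM mulnC exprM unity_root_exp.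
    by rewrite expr1n mulr1.
  have u1 : u k - 1 != 0.
    rewrite /u -(divff (z0 k)) -mulrBl mulf_neq0 ?invr_eq0 //.
    by rewrite opprB addrA subrK -opprB oppr_eq0.
  apply: (mulfI u1); rewrite -subrX1 uN /u; field.
  by rewrite zx z0.
(* By orthogonality of the powers of the root of unity only j = 0 contributes. *)
have ave : (2 ^+ n)^-1 * \sum_(k < N) \sum_(j < N) u k ^+ j = 1.
  rewrite exchange_big /=.
  have Npos : (0 < N)%N by rewrite expn_gt0.
  rewrite (bigD1 (Ordinal Npos)) //= [X in _ + X]big1 => [|j jn0].
    under eq_bigr do rewrite expr0.
    by rewrite addr0 sumr_const card_ord natrX mulVf.
  have j0 : (0 < j)%N by rewrite lt0n; apply: contra_neq jn0 => h; apply: val_inj.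
  have jN := ltn_ord j.
  have uE k : u k ^+ j = ((x - c) / r%:C) ^+ j * unity_root n ^+ ((N - j) * k).
    have wk : unity_root n ^+ ((N - j) * k) = (unity_root n ^+ (j * k))^-1 :> R[i].
      apply: (mulIf (_ : unity_root n ^+ (j * k) != 0)).
        by rewrite expf_neq0 // cis_neq0.
      rewrite mulVf ?expf_neq0 ?cis_neq0 // -exprD -mulnDl subnK ?(ltnW jN) //.
      by rewrite exprM unity_root_exp expr1n.
    by rewrite wk /u zetaB invfM mulrA exprMn exprVn -exprM [(k * j)%N]mulnC.
  under eq_bigr do rewrite uE.
  rewrite -mulr_sumr unity_root_sum ?mulr0 // subn_gt0 jN /=.
  by rewrite ltn_subrL j0 Npos.
have -> : \sum_(j < N) ((2 ^+ n)^-1 *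
      \sum_(k < N) f (zeta n k) / (zeta n k - c) ^+ j) * (x - c) ^+ j - f x =
   (1 - Q) * ((2 ^+ n)^-1 * \sum_(k < N) (zeta n k - c) * g (zeta n k)).
  transitivity ((2 ^+ n)^-1 * (\sum_(k < N) f (zeta n k) * \sum_(j < N) u k ^+ j)
      - (2 ^+ n)^-1 * (\sum_(k < N) f x * \sum_(j < N) u k ^+ j)).
    congr (_ - _); last by rewrite -mulr_sumr mulrCA ave mulr1.
    under [in RHS]eq_bigr do rewrite mulr_sumr.
    rewrite exchange_big mulr_sumr; apply: eq_bigr => j _.
    rewrite -mulrA mulr_suml; congr (_ * _); apply: eq_bigr => k _.
    by rewrite /u expr_div_n mulrA mulrAC.
  rewrite -mulrBr -sumrB mulrCA [in RHS]mulr_sumr; congr (_ * _).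
  by apply: eq_bigr => k _; rewrite -mulrBl geo /g; ring.
rewrite normcM.
have Q1 : normc (1 - Q) <= 2.
  have hQ : normc Q <= 1.
    rewrite normcX exprn_ile1 ?normc_ge0 // normcM normcV normc_real gtr0_norm //.
    by rewrite ler_pdivrMr // mul1r ltW.
  apply: le_trans (normcB_le _ _) _; rewrite normc1.
  by have := lerD (lexx (1 : R)) hQ; lra.
by have := ler_pM (normc_ge0 _) (normc_ge0 _) Q1 hn; lra.
Qed.

End Point.
End DiscreteCauchy.

(** * The error estimate *)

Lemma bernstein_error_le (R : realType) (f : R[i] -> R[i]) (c r rho M eps : R)
    N (z : R[i]) :
  0 <= c <= 1 -> c <= r -> 1 - c <= r -> r < rho ->
  (forall w, normc (w - c%:C) <= rho -> complex_diff f w) ->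
  (forall t, 0 <= t <= 1 -> normc (f (circ c%:C rho t)) <= M) ->
  (0 < N)%N -> 0 <= eps <= 1 -> normc (z - c%:C) <= r ->
  normc (bsum z N (fun nu => f (nu%:R * (1 - eps) / N%:R)%:C) - f z) <=
    4 * M / (1 - r / rho) ^+ 3 * (N%:R^-1 + eps).
Proof.
move=> c01 cr cr' rrho df fM N0 eps01 hz.
have /andP[c0 c1] := c01; have /andP[e0 e1] := eps01.
have r0 : 0 <= r by exact: le_trans cr.
have rho0 : 0 < rho by exact: le_lt_trans rrho.
have n0 : 0 < N%:R :> R by rewrite ltr0n.
have M0 : 0 <= M by apply: le_trans (normc_ge0 _) (fM 0 _); rewrite lexx ler01.
pose x nu : R := nu%:R * (1 - eps) / N%:R.
have x01 nu : (nu <= N)%N -> 0 <= x nu <= 1.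
  move=> h; rewrite /x divr_ge0 ?mulr_ge0 ?subr_ge0 //= ler_pdivrMr // mul1r.
  have h' : nu%:R <= N%:R :> R by rewrite ler_nat.
  have : 0 <= nu%:R * eps by rewrite mulr_ge0.
  by lra.
have xc nu : (nu <= N)%N -> normc ((x nu)%:C - c%:C) <= r.
  move=> /x01/andP[h1 h2]; rewrite -rmorphB normc_real ler_norml; lra.
apply/ler_addgt0Pr => e epos.
(* The moduli of the weights may sum to more than 1 at complex z, but [W] is fixed before the
   polynomial is chosen. The error [e'] at z and at the nodes then costs (W + 1) e' = e. *)
pose W : R := \sum_(0 <= nu < N.+1)
  normc (('C(N, nu))%:R * z ^+ nu * (1 - z) ^+ (N - nu)).
have W0 : 0 <= W by apply: sumr_ge0 => nu _; exact: normc_ge0.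
pose e' := e / (W + 1).
have e'0 : 0 < e' by rewrite divr_gt0 // ltr_wpDl.
pose a n j := (2 ^+ n)^-1 * \sum_(k < 2 ^ n)
   f (circ c%:C rho (k%:R / 2 ^+ n)) / (circ c%:C rho (k%:R / 2 ^+ n) - c%:C) ^+ j.
pose p n w := \sum_(j < 2 ^ n) a n j * (w - c%:C) ^+ j.
have pcvg w : normc (w - c%:C) <= r -> exists m, forall n, (m <= n)%N ->
    normc (p n w - f w) <= e'.
  by move=> hw; apply: (circle_interpolation_cvg _ _ _ rho0 df) => //; exact: le_lt_trans rrho.
have [m0 hm0] := pcvg z hz.
have /choice[m hm] : forall nu, exists m, (nu <= N)%N -> forall n, (m <= n)%N ->
    normc (p n (x nu)%:C - f (x nu)%:C) <= e'.
  move=> nu; have [/xc/pcvg[k hk]|_] := leqP nu N; first by exists k.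
  by exists 0%N.
(* Only z and the N + 1 nodes matter, so pointwise convergence of [p] suffices. *)
pose n := maxn m0 (\max_(nu < N.+1) m nu).
have hz' : normc (p n z - f z) <= e' by apply: hm0; rewrite leq_maxl.
have hx' nu : (nu <= N)%N -> normc (p n (x nu)%:C - f (x nu)%:C) <= e'.
  move=> h; apply: hm => //; rewrite leq_max; apply/orP; right.
  exact: (leq_bigmax (Ordinal (h : (nu < N.+1)%N))).
have an j : normc (a n j) <= M / rho ^+ j.
  rewrite /a normcM normcV normcX normc_nat ler_pdivrMl ?exprn_gt0 //.
  have -> : 2 ^+ n * (M / rho ^+ j) = \sum_(k < 2 ^ n) (M / rho ^+ j).
    by rewrite sumr_const card_ord -natrX mulr_natl.
  apply: le_trans (normc_sum _ _ _ _) _; apply: ler_sum => k _.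
  rewrite normcM normcV normcX normc_circB // ler_wpM2r ?invr_ge0 ?exprn_ge0 ?(ltW rho0) //.
  by apply: fM; apply: dyadic01; exact: ltnW.
set q := r / rho.
have q01 : 0 <= q < 1 by rewrite divr_ge0 ?(ltW rho0) //= ltr_pdivrMr // mul1r.
set S := N%:R^-1 + eps.
have S0 : 0 <= S by rewrite addr_ge0 // invr_ge0.
have hp : normc (bsum z N (fun nu => p n (x nu)%:C) - p n z) <= 4 * M / (1 - q) ^+ 3 * S.
  rewrite bsum_sum -sumrB.
  apply: le_trans (normc_sum _ _ _ _) _.
  have hj (j : 'I_(2 ^ n)) : normc (bsum z N (fun nu => a n j * ((x nu)%:C - c%:C) ^+ j)
       - a n j * (z - c%:C) ^+ j) <= 2 * M * S * (j%:R ^+ 2 * q ^+ j).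
    rewrite bsumZ -mulrBr normcM.
    have h := normc_bsum_powB_le _ _ c01 cr cr' _ _ N j N0 eps01 hz.
    apply: le_trans (ler_pM (normc_ge0 _) (normc_ge0 _) (an j) h) _.
    rewrite le_eqVlt; apply/orP; left; apply/eqP.
    by rewrite /q expr_div_n -/S; ring.
  apply: le_trans (ler_sum _ (fun j _ => hj j)) _.
  rewrite -mulr_sumr.
  have h2 : 0 <= 2 * M * S by rewrite !mulr_ge0.
  apply: le_trans (ler_wpM2l h2 (sum_sqr_geo_le _ _ q01)) _.
  by rewrite le_eqVlt; apply/orP; left; apply/eqP; ring.
have hr : normc (bsum z N (fun nu => p n (x nu)%:C) - bsum z N (fun nu => f (x nu)%:C)) <= W * e'.
  rewrite /bsum -sumrB; apply: le_trans (normc_sum _ _ _ _) _.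
  rewrite /W mulr_suml big_nat [leRHS]big_nat; apply: ler_sum => nu /andP[_ hnu].
  rewrite -mulrBr normcM; apply: ler_wpM2l; first exact: normc_ge0.
  exact: hx'.
set T := bsum z N (fun nu => f _).
set P := bsum z N (fun nu => p n _) in hp hr.
have -> : T - f z = (P - p n z) + ((p n z - f z) - (P - T)) by ring.
apply: le_trans (normcD_le _ _) _; apply: lerD => //.
apply: le_trans (normcB_le _ _) _.
apply: le_trans (lerD hz' hr) _.
have -> : e' + W * e' = e by rewrite /e'; field; rewrite gt_eqF // ltr_wpDl.
exact: lexx.
Qed.

(** * Compact subsets of the disc and uniform convergence *)

Section ComplexCompact.
Context {R : realType}.

Lemma compact_circ (c : R[i]) (r : R) : 0 < r ->
  compact (circ c r @` `[0, 1]%classic : set R[i]^o).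
Proof.
move=> r0; apply: (@continuous_compact R (R[i]^o : topologicalType)); last exact: segment_compact.
apply: continuous_subspaceT => t; apply/cvgrPdist_le => eps epos.
have [epsE e0] := gtc0_real _ epos.
have C0 : 0 < 4 * pi * r by rewrite !mulr_gt0 ?pi_gt0.
apply/nbhs_ballP; exists (complex.Re eps / (4 * pi * r)).
  by rewrite /= divr_gt0.
move=> s; rewrite /ball /= ltr_pdivlMr // => hs.
rewrite normr_normc epsE lecR.
apply: le_trans (normc_circ_dist _ _ r0 _ _) _.
by rewrite mulrC ltW.
Qed.

(** |z - c| attains its maximum on K, at a point of the open disc. *)
Lemma compact_sub_cdisc (c rho : R) (K : set R[i]) : 0 < rho ->
  compact (K : set R[i]^o) -> K `<=` cdisc c rho ->
  exists2 r : R, r < rho & forall z, K z -> normc (z - c%:C) <= r.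
Proof.
move=> rho0 cK Krho.
have [->|/set0P K0] := eqVneq K set0; first by exists 0.
have [|w wK hw] := @compact_EVT_max R[i]^o R (fun z => normc (z - c%:C)) K K0 cK.
  apply: continuous_subspaceT => z A /nbhs_ballP[e e0 hA].
  apply/(@nbhs_ballP R[i] R[i]^o); exists e%:C; first by rewrite /= ltcR.
  move=> y; rewrite /ball /= normr_normc ltcR => hy.
  apply: hA; rewrite /ball /=; apply: le_lt_trans hy.
  have h1 := normcD_le (z - y) (y - c%:C).
  have h2 := normcD_le (y - z) (z - c%:C).
  rewrite addrA subrK (normc_distC y z) in h2; rewrite addrA subrK in h1.
  by rewrite ler_norml; apply/andP; split; lra.
exists (normc (w - c%:C)).
  by have := Krho w (set_mem wK); rewrite /cdisc /= normr_normc ltcR.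
by move=> z /mem_set; exact: hw.
Qed.

End ComplexCompact.

Lemma archi_inv_lt (R : realType) (C e : R) : 0 < e ->
  exists2 n : nat, (0 < n)%N & forall N, (n <= N)%N -> C * N%:R^-1 <= e.
Proof.
move=> e0; exists (Num.bound (C / e)).+1 => // N hN.
have N0 : 0 < N%:R :> R by rewrite ltr0n (leq_trans _ hN).
rewrite ler_pdivrMr // mulrC -ler_pdivrMr //.
have [h|h] := leP 0 (C / e); last by rewrite (le_trans (ltW h)).
apply: le_trans (ltW (archi_boundP h)) _.
by rewrite ler_nat ltnW.
Qed.

Lemma uniform_cvg_normc (R : realType) (K : set R[i]) (F : nat -> R[i] -> R[i])
    (f : R[i] -> R[i]) :
  (forall e : R, 0 < e -> exists N0, forall N, (N0 <= N)%N ->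
     forall z, K z -> normc (F N z - f z) < e) ->
  {uniform (K : set R[i]^o), (fun N => (F N : R[i]^o -> R[i]^o)) @ \oo
     --> (f : R[i]^o -> R[i]^o)}.
Proof.
move=> h P /uniform_nbhs[E [entE EP]].
move: entE; rewrite -entourage_ballE => -[e /= e0 eE].
have [epsE e0'] := gtc0_real _ e0.
have [N0 hN0] := h _ e0'.
exists N0 => // N hN /=; apply: EP => z Kz; apply: eE.
rewrite /ball /= normr_normc epsE ltcR normc_distC; exact: hN0.
Qed.

Theorem mainTheorem1 (R : realType) (c rho : R) (I I' : Type)
    (G : I -> R[i] -> R[i]) (eps : I' -> nat -> R) :
  0 <= c <= 1 ->
  Num.max c (1 - c) < rho ->
  bounded_family_H (cdisc c rho) G ->
  (forall j N, (1 <= N)%N -> 0 <= eps j N <= 1) ->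
  (forall e : R, 0 < e -> exists N0 : nat,
      forall N, (N0 <= N)%N -> forall j, eps j N <= e) ->
  (forall i j (K : set R[i]), compact (K : set R[i]^o) -> K `<=` cdisc c rho ->
     {uniform (K : set R[i]^o),
        (fun N => (bernsteinP (G i) (eps j) N : R[i]^o -> R[i]^o)) @ \oo
        --> (G i : R[i]^o -> R[i]^o)}) /\
  (forall K : set R[i], compact (K : set R[i]^o) -> K `<=` cdisc c rho ->
     forall e : R, 0 < e -> exists N0 : nat,
       forall N, (N0 <= N)%N -> forall i j z, K z ->
         `|bernsteinP (G i) (eps j) N z - G i z| < e%:C).
Proof.
move=> c01 crho [Gdiff Gbnd] eps01 eps0.
have /andP[c0 c1] := c01.
have rho0 : 0 < rho by apply: le_lt_trans crho; rewrite le_max c0.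
have main (K : set R[i]) : compact (K : set R[i]^o) -> K `<=` cdisc c rho ->
    forall e : R, 0 < e -> exists N0 : nat, forall N, (N0 <= N)%N ->
      forall i j z, K z -> normc (bernsteinP (G i) (eps j) N z - G i z) < e.
  move=> cK Krho e e0.
  have [s srho hs] := compact_sub_cdisc c rho K rho0 cK Krho.
  (* The radius must cover K and also satisfy c <= r and 1 - c <= r, as the moment bounds
     require. *)
  pose r := Num.max s (Num.max c (1 - c)).
  have rrho : r < rho by rewrite /r gt_max srho.
  have cr : c <= r by rewrite /r !le_max lexx orbT.
  have cr' : 1 - c <= r by rewrite /r !le_max lexx !orbT.
  have sr : s <= r by rewrite /r le_max lexx.
  (* The midpoint leaves room on both sides: the circle of radius [rh] is compact in the disc, which
     gives a bound common to all i, and r / rh < 1. *)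
  pose rh := (r + rho) / 2.
  have r_rh : r < rh by rewrite /rh; lra.
  have rh_rho : rh < rho by rewrite /rh; lra.
  have rh0 : 0 < rh by apply: le_lt_trans r_rh; exact: le_trans cr.
  have [|M hM] := Gbnd _ (compact_circ c%:C rh rh0).
    by move=> _ [t _ <-]; rewrite /cdisc /= normr_normc normc_circB // ltcR.
  pose C := 4 * Num.max M 0 / (1 - r / rh) ^+ 3.
  have C0 : 0 <= C.
    have M0 : 0 <= Num.max M 0 by rewrite le_max lexx orbT.
    apply: divr_ge0; [exact: mulr_ge0|apply: exprn_ge0].
    by rewrite subr_ge0 ler_pdivrMr // mul1r ltW.
  have e3 : 0 < e / 3 by rewrite divr_gt0.
  have [n1 n10 hn1] := archi_inv_lt R C _ e3.
  (* C / N and C eps each take a third of e; C + 1 is positive even if C = 0. *)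
  have [n2 hn2] := eps0 (e / 3 / (C + 1)) (divr_gt0 e3 (ltr_wpDl C0 ltr01)).
  exists (maxn n1 n2) => N; rewrite geq_max => /andP[h1 h2] i j z Kz.
  have N0 : (0 < N)%N by exact: leq_trans h1.
  have := @bernstein_error_le R (G i) c r rh (Num.max M 0) (eps j N) N z
    c01 cr cr' r_rh _ _ N0 (eps01 j N N0) (le_trans (hs z Kz) sr).
  move=> H; apply: le_lt_trans (H _ _) _.
  - move=> w hw; apply/complex_diffP; apply: Gdiff.
    by rewrite /cdisc /= normr_normc ltcR; exact: le_lt_trans rh_rho.
  - move=> t t01; rewrite le_max -lecR; apply/orP; left.
    by apply: (hM i); exists t => //=; rewrite in_itv.
  rewrite -/C mulrDr.
  have k1 := hn1 N h1.
  have k2 : C * eps j N <= e / 3.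
    have := hn2 N h2 j; rewrite ler_pdivlMr ?ltr_wpDl //.
    have /andP[? _] := eps01 j N N0.
    by lra.
  by lra.
split=> [i j K cK Krho|K cK Krho e e0].
  apply: uniform_cvg_normc => e e0; have [N0 h] := main K cK Krho e e0.
  by exists N0 => N hN z Kz; exact: h.
have [N0 h] := main K cK Krho e e0.
by exists N0 => N hN i j z Kz; rewrite normr_normc ltcR; exact: h.
Qed.
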